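(* Let $p>1$, $\lambda>0$, and assume that $0<q<p-1$ and $\sigma\not\equiv 0$ on $\partial S$. Then every solution $u$ of the problem $$\begin{cases} u_t(x,t)=\Delta_{p,\omega}u(x,t)+\lambda|u(x,t)|^{q-1}u(x,t), & (x,t)\in S\times(0,\infty),\\ \mu(z)\frac{\partial u}{\partial_p n}(z,t)+\sigma(z)|u(z,t)|^{p-2}u(z,t)=0, & (z,t)\in\partial S\times[0,\infty),\\ u(x,0)=u_0(x)\ge 0, & x\in\overline S,\end{cases}$$ is global. More precisely, every solution $u$ satisfies $$\sum_{x\in S}u^2(x,t)\le\max\left\{\sum_{x\in S}u_0^2(x),\left[\frac{\lambda|S|^{\frac{p-2}2}}{\lambda_{p,0}}\right]^{\frac2{p-q-1}},\left[\frac{\lambda|S|^{\frac{p-q-1}2}}{\lambda_{p,0}}\right]^{\frac2{p-q-1}},\left[\frac{\lambda|S|^{\frac{1-q}2}}{\lambda_{p,0}}\right]^{\frac2{p-q-1}}\right\}$$ for all $t\ge 0$.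
   Context: Network: $G=(V,E)$ is a finite, connected, simple graph with a weight $\omega:V\times V\to[0,\infty)$, i.e. $\omega(x,x)=0$, $\omega(x,y)=\omega(y,x)$, and $\omega(x,y)>0$ iff $x\sim y$ ($x,y$ adjacent). $S$ is a connected induced subgraph of $G$ (identified with its vertex set), $|S|$ is its number of vertices, $\partial S=\{z\in V\setminus S: y\sim z\text{ for some }y\in S\}$, and $\overline S=S\cup\partial S$ is the network whose edges are the edges of $G$ with at least one endpoint in $S$ (so there are no edges between two vertices of $\partial S$ in $\overline S$, and $\omega$ is regarded as $0$ there). Operators, for $u:\overline S\to\mathbb R$, with the convention $|a|^{p-2}a=0$ if $a=0$: $\Delta_{p,\omega}u(x)=\sum_{y\in\overline S}|u(x)-u(y)|^{p-2}[u(y)-u(x)]\omega(x,y)$ for $x\in\overline S$, and $\frac{\partial u}{\partial_p n}(z)=\sum_{y\in S}|u(z)-u(y)|^{p-2}[u(z)-u(y)]\omega(z,y)$ for $z\in\partial S$. For functions of $(x,t)$ they act in the variable $x$. Boundary coefficients: $\mu,\sigma:\partial S\to[0,\infty)$ with $\mu(z)+\sigma(z)>0$ for all $z\in\partial S$; $\Gamma=\{z\in\partial S:\mu(z)>0\}$. First eigenvalue: $$\lambda_{p,0}=\min_{u\in\mathcal A}\frac{\frac12\sum_{x,y\in\overline S}|u(x)-u(y)|^p\omega(x,y)+\sum_{z\in\Gamma}\frac{\sigma(z)}{\mu(z)}|u(z)|^p}{\sum_{x\in S}|u(x)|^p},$$ where $\mathcal A=\{u:\overline S\to\mathbb R: u\not\equiv0\text{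 in }S,\ u=0\text{ on }\partial S\setminus\Gamma\}$ and the sum over $\Gamma$ is $0$ if $\Gamma=\emptyset$. One has $\lambda_{p,0}>0$ when $\sigma\not\equiv0$. There is a function $\phi_0$ on $\overline S$, positive on $S\cup\Gamma$, with $-\Delta_{p,\omega}\phi_0=\lambda_{p,0}|\phi_0|^{p-2}\phi_0$ on $S$ and $\mu\frac{\partial\phi_0}{\partial_p n}+\sigma|\phi_0|^{p-2}\phi_0=0$ on $\partial S$ (known facts). Solution: a function $u$ on $\overline S\times[0,T)$, $0<T\le\infty$, with $u(x,\cdot)$ continuous on $[0,T)$ and differentiable in $(0,T)$ for each $x\in\overline S$, satisfying the problem for times in $[0,T)$, where $[0,T)$ is a maximal interval of existence. The solution is global if $T=\infty$. *)

(* Defs.v *)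
From HB Require Import structures.
From mathcomp Require Import all_boot all_order all_algebra.
From mathcomp Require Import all_classical all_reals all_analysis.
Import Order.TTheory GRing.Theory Num.Theory.
Import numFieldNormedType.Exports.

Set Implicit Arguments.
Unset Strict Implicit.
Unset Printing Implicit Defensive.

Local Open Scope classical_set_scope.
Local Open Scope ring_scope.

Definition connected_in (V : finType) (e : rel V) (S : {set V}) : Prop :=
  S != finset.set0 /\
  {in S &, forall x y, connect [rel a b | [&& a \in S, b \in S & e a b]] x y}.

Record network (R : realType) (V : finType) := Network {
  adj : rel V;
  weight : V -> V -> R;
  adj_irr : irreflexive adj;
  adj_sym : symmetric adj;
  adj_connected : connected_in adj [set: V]%SET;
  weight_ge0 : forall x y, 0 <= weight x y;
  weight_diag : forall x, weight x x = 0;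
  weight_sym : forall x y, weight x y = weight y x;
  weight_gt0 : forall x y, (0 < weight x y) = adj x y }.

(* spow r a is |a|^r a. The factor a makes it vanish at a = 0 for every
   exponent r, negative ones and r = 0 included. *)
Definition spow (R : realType) (r a : R) : R := `|a| `^ r * a.

Section Domain.
Context {R : realType} {V : finType} (G : network R V) (S : {set V}).

Definition boundary : {set V} :=
  [set z | (z \notin S) && [exists y in S, adj G y z]]%SET.

Definition closed_dom : {set V} := S :|: boundary.

(* The weight of the network on closed_dom: edges joining two boundary
   vertices are dropped. *)
Definition dom_weight (x y : V) : R :=
  if (x \in S) || (y \in S) then weight G x y else 0.

(* A function on closed_dom is represented by a function on V; its values
   outside closed_dom are never used. *)
Definition plaplacian (p : R) (u : V -> R) (x : V) : R :=
  \sum_(y in closed_dom)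
    `|u x - u y| `^ (p - 2) * (u y - u x) * dom_weight x y.

Definition pnormal_derivative (p : R) (u : V -> R) (z : V) : R :=
  \sum_(y in S) `|u z - u y| `^ (p - 2) * (u z - u y) * dom_weight z y.

Definition Gamma (mu : V -> R) : {set V} :=
  [set z in boundary | 0 < mu z]%SET.

Definition admissible (mu : V -> R) : set (V -> R) :=
  [set u | (exists2 x, x \in S & u x != 0) /\
           (forall z, z \in boundary -> z \notin Gamma mu -> u z = 0)].

Definition rayleigh (p : R) (mu sigma : V -> R) (u : V -> R) : R :=
  (2^-1 * (\sum_(x in closed_dom) \sum_(y in closed_dom)
             `|u x - u y| `^ p * dom_weight x y)
   + \sum_(z in Gamma mu) sigma z / mu z * `|u z| `^ p)
  / \sum_(x in S) `|u x| `^ p.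

(* The infimum is attained (finite dimension, homogeneity), so this is the
   minimum of the Rayleigh quotient. *)
Definition first_eigenvalue (p : R) (mu sigma : V -> R) : R :=
  inf [set rayleigh p mu sigma u | u in admissible mu].

(* u solves, on the time interval [0, T), the initial boundary value problem
   with reaction term lambda |u|^(q-1) u. The end point T may be +oo. *)
Record solution (p q lambda : R) (mu sigma u0 : V -> R)
    (T : \bar R) (u : V -> R -> R) : Prop := Solution {
  sol_time : (0 < T)%E;
  sol_continuous : forall x, x \in closed_dom ->
    {within [set t : R | 0 <= t /\ (t%:E < T)%E], continuous (u x)};
  sol_derivable : forall x (t : R), x \in closed_dom ->
    0 < t -> (t%:E < T)%E -> derivable (u x) t 1;
  sol_equation : forall x (t : R), x \in S -> 0 < t -> (t%:E < T)%E ->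
    derive1 (u x) t = plaplacian p (u ^~ t) x + lambda * spow (q - 1) (u x t);
  sol_boundary : forall z (t : R), z \in boundary -> 0 <= t -> (t%:E < T)%E ->
    mu z * pnormal_derivative p (u ^~ t) z + sigma z * spow (p - 2) (u z t) = 0;
  sol_initial : forall x, x \in closed_dom -> u x 0 = u0 x }.

(* [0, T) is a maximal interval of existence: u has no proper continuation. *)
Definition maximal_solution (p q lambda : R) (mu sigma u0 : V -> R)
    (T : \bar R) (u : V -> R -> R) : Prop :=
  solution p q lambda mu sigma u0 T u /\
  forall (T' : \bar R) (v : V -> R -> R),
    solution p q lambda mu sigma u0 T' v -> (T <= T')%E ->
    (forall x (t : R), x \in closed_dom -> 0 <= t -> (t%:E < T)%E ->
       v x t = u x t) ->
    T' = T.

End Domain.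

(* Main.v *)
Require Import Defs.
From mathcomp Require Import all_boot all_order all_algebra.
From mathcomp Require Import all_classical all_reals all_analysis.
From mathcomp Require Import ring lra.
Import Order.TTheory GRing.Theory Num.Theory.
Import numFieldNormedType.Exports.

(** The bound is an energy estimate.  Multiplying the equation by [u] and summing
by parts over the domain, the mass M(t), the sum of [u x t ^+ 2] over [S],
satisfies
    M' = 2 (lambda * Q - E),
where Q is the sum of |u|^(q+1) over [S] and E is the numerator of the Rayleigh
quotient ([green_identity], [is_derive_mass]).  By definition of the first
eigenvalue, E is at least lambda_p0 times the sum P of |u|^p
([first_eigenvalue_le]).  Since q + 1 < p, comparing Q and P with powers of M
shows lambda * Q <= lambda_p0 * P as soon as M exceeds the three constants of the
statement ([reaction_absorbed]); this needs lambda_p0 > 0, which is a Poincare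
inequality propagated along the paths of the connected set [S] from a boundary
vertex where [sigma] does not vanish ([first_eigenvalue_gt0]).  A function that
cannot increase while it is above a level never crosses it ([barrier]), whence
the bound on the whole interval of existence ([mass_le_bound]).

For globality, suppose that the maximal time T is finite.  The boundary condition
at z says that the value at z is the balance point of strictly increasing forces
exerted by the values in [S] and, through [sigma], by the value 0.  It is thus a
function of the inner values, a nonlinear weighted mean ([pmean]), nonexpansive
for the sup norm.  Hence the problem is an autonomous system on [S] with a
continuous right-hand side ([rd_field]).  By the first part the solution stays
bounded, so it is Lipschitz in time and has a limit at T, and a solution of the
system issued from this limit prolongs it beyond T ([glued_trajectory]).  The
right-hand side need not be Lipschitz when p < 2 or q < 1, so that this solution
comes from the Peano theorem ([peano_existence]).

The prolongation has to be differentiable at the boundary vertices too, although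
the mean is not a differentiable function of its arguments: for p > 2 it may have
a corner where all of them coincide, and for p < 2 where several of them equal the
mean.  At such points it is however governed by a homogeneous odd function, so
that it is differentiable along every differentiable curve
([pmean_curve_slope]).  The prolongation is therefore a solution, against the
maximality of T. *)

Set Implicit Arguments.
Unset Strict Implicit.
Unset Printing Implicit Defensive.

Local Open Scope classical_set_scope.
Local Open Scope ring_scope.

(** * Signed powers *)

Section SignedPower.
Context {R : realType}.
Implicit Types r x y : R.

Lemma spow0 r : spow r 0 = 0.
Proof. by rewrite /spow mulr0. Qed.

Lemma spowN r x : spow r (- x) = - spow r x.
Proof. by rewrite /spow normrN mulrN. Qed.

(** Multiplicativity carries both the homogeneity and the oddness of the signed
power: it lets a factor of either sign be pulled out of [spow]. *)
Lemma spowM r x y : spow r (x * y) = spow r x * spow r y.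
Proof. by rewrite /spow normrM powRM // mulrACA. Qed.

Lemma norm_spow r x : -1 < r -> `|spow r x| = `|x| `^ (r + 1).
Proof.
move=> r1; rewrite /spow normrM ger0_norm ?powR_ge0 // mulrC.
have r0 : 0 < r + 1 by lra.
by rewrite -(@mulr_powRB1 _ `|x| (r + 1)) // addrK.
Qed.

Lemma mulr_spow r x : -1 < r -> x * spow r x = `|x| `^ (r + 2).
Proof.
move=> r1; rewrite -(ger0_norm (_ : 0 <= x * spow r x)); last first.
  by rewrite /spow mulrCA -expr2 mulr_ge0 ?powR_ge0 ?sqr_ge0.
rewrite normrM norm_spow // -(@mulr_powRB1 _ `|x| (r + 2)) //; last by lra.
by congr (_ * _ `^ _); lra.
Qed.

Lemma spow_ge0 r x : 0 <= x -> 0 <= spow r x.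
Proof. by move=> x0; rewrite mulr_ge0 // powR_ge0. Qed.

Lemma ger0_spow r x : -1 < r -> 0 <= x -> spow r x = x `^ (r + 1).
Proof.
by move=> r1 x0; rewrite -[LHS]ger0_norm ?spow_ge0 // norm_spow // ger0_norm.
Qed.

Lemma spow_lt r x y : -1 < r -> x < y -> spow r x < spow r y.
Proof.
move=> r1; have r0 : 0 < r + 1 by lra.
have pos a b : 0 <= a -> a < b -> spow r a < spow r b.
  move=> a0 ab; rewrite !ger0_spow ?(le_trans a0 (ltW ab)) //.
  by rewrite gt0_ltr_powR // nnegrE ?(le_trans a0 (ltW ab)).
case: (leP 0 x) => [x0|x0] xy; first exact: pos.
case: (leP y 0) => [y0|y0].
  by rewrite -ltrN2 -!spowN pos ?oppr_ge0 // ltrN2.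
apply: (@lt_trans _ _ (spow r 0)); last exact: pos.
by rewrite -ltrN2 -!spowN oppr0 pos // oppr_gt0.
Qed.

Lemma spow_le r x y : -1 < r -> x <= y -> spow r x <= spow r y.
Proof.
move=> r1; rewrite le_eqVlt => /predU1P[-> //|xy].
exact/ltW/spow_lt.
Qed.

Lemma spow_eq0 r x : (spow r x == 0) = (x == 0).
Proof.
by rewrite /spow mulf_eq0 powR_eq0 normr_eq0; case: (x == 0); rewrite ?orbT.
Qed.

(** On the positive half-line [spow r] is the power of exponent r + 1; the negative
half-line follows by oddness. *)
Lemma is_derive_spow r x : x != 0 -> is_derive x 1 (spow r) ((r + 1) * `|x| `^ r).
Proof.
have pos y : 0 < y -> is_derive y 1 (spow r) ((r + 1) * `|y| `^ r).
  move=> y0.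
  have dp : is_derive y 1 (fun z : R => z `^ r * z)
      (y `^ r *: 1 + y *: (r * y `^ (r - 1))).
    by apply: is_deriveM; apply: is_derive1_powR.
  apply: (@near_eq_is_derive _ _ _ (fun z : R => z `^ r * z)).
  - near=> z; rewrite /spow ger0_norm //.
    by apply: ltW; near: z; exact: lt_nbhsr.
  apply: is_derive_eq dp _.
  rewrite /GRing.scale /= mulr1 gtr0_norm // mulrCA.
  rewrite mulrDl mul1r addrC; congr (_ * _ + _).
  have ypow : y `^ (1 + (r - 1)) = y `^ 1 * y `^ (r - 1).
    by apply: powRD; rewrite (lt0r_neq0 y0) implybT.
  by rewrite powRr1 ?ltW // in ypow; rewrite -ypow subrKC.
rewrite neq_lt => /orP[x0|]; last exact: pos.
have dN : is_derive (- x) 1 (spow r) ((r + 1) * `|x| `^ r).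
  by rewrite -(normrN x); apply: pos; rewrite oppr_gt0.
have -> : spow r = (fun z : R => - spow r (- z)).
  by apply/funext => z; rewrite spowN opprK.
have := @is_deriveN _ _ _ _ _ _ _ (@is_derive1_comp _ _ _ _ _ _ dN
  (is_deriveN (is_derive_id x 1))).
move=> h; apply: is_derive_eq h _.
by rewrite mulrN1 opprK.
Unshelve. all: by end_near. Qed.

Lemma continuous_spow r : -1 < r -> continuous (spow r).
Proof.
move=> r1 x; have [->|x0] := eqVneq x 0; last first.
  apply: differentiable_continuous; apply/derivable1_diffP.
  by case: (is_derive_spow r x0).
have r0 : 0 < r + 1 by lra.
rewrite /continuous_at spow0; apply/cvgr0Pnorm_lt => e e0.
have d0 : 0 < e `^ (r + 1)^-1 by rewrite powR_gt0.
near=> y; rewrite norm_spow //.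
have yd : `|y| < e `^ (r + 1)^-1.
  near: y; apply/nbhs_ballP; exists (e `^ (r + 1)^-1) => // z.
  by rewrite /ball /= sub0r normrN.
have : `|y| `^ (r + 1) < (e `^ (r + 1)^-1) `^ (r + 1).
  by rewrite gt0_ltr_powR // nnegrE ?powR_ge0.
by rewrite -powRrM mulVf ?gt_eqF // powRr1 // ltW.
Unshelve. all: by end_near. Qed.

End SignedPower.

Lemma cvg_sumr (R : realType) (T : Type) (F : set_system T) {FF : Filter F}
    (I : Type) (s : seq I) (P : pred I) (f : I -> T -> R) (l : I -> R) :
  (forall i, P i -> f i x @[x --> F] --> l i) ->
  \sum_(i <- s | P i) f i x @[x --> F] --> \sum_(i <- s | P i) l i.
Proof.
move=> fl; apply: cvg_big => //.
exact: add_continuous.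
Qed.

(** * Nonlinear weighted means *)

Section PMean.
Context {R : realType} {I : finType}.
Implicit Types (W a b : I -> R) (r x y : R).

(** Up to sign, the force on a point at position [x] tied to the positions [a i] by
springs of strength [W i] whose law is the signed power of exponent r + 1. *)
Definition balance W r a x := \sum_i W i * spow r (x - a i).

(** The equilibrium position.  For r = 0 it is the weighted average of the [a i]. *)
Definition pmean W r a := xget 0 [set x | balance W r a x = 0].

Section Weights.
Variables (W : I -> R) (r : R).
Hypotheses (r_gt : -1 < r) (W_ge0 : forall i, 0 <= W i).
Hypothesis W_gt0 : exists i, 0 < W i.

Lemma balance_lt a x y : x < y -> balance W r a x < balance W r a y.
Proof.
case: W_gt0 => i Wi xy; rewrite /balance (bigD1 i) //= [ltRHS](bigD1 i) //=.
apply: ltr_leD; first by rewrite ltr_pM2l // spow_lt // ltrD2r.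
by apply: ler_sum => j _; rewrite ler_wpM2l // spow_le // lerD2r ltW.
Qed.

Lemma balance_ge a b x y :
  (forall i, 0 < W i -> x - a i <= y - b i) -> balance W r a x <= balance W r b y.
Proof.
move=> h; apply: ler_sum => i _; have := W_ge0 i.
rewrite le_eqVlt => /predU1P[<-|Wi]; first by rewrite !mul0r.
by rewrite ler_pM2l // spow_le // h.
Qed.

Lemma balance_lt_inv a x y : balance W r a x < balance W r a y -> x < y.
Proof. by rewrite !ltNge; apply: contra => h; apply: balance_ge => i _; lra. Qed.

Lemma continuous_balance a : continuous (balance W r a).
Proof.
move=> x; rewrite /balance; apply: cvg_sumr => i _.
apply: cvgM; first exact: cvg_cst.
apply: (@continuous_comp _ _ _ (fun y : R => y - a i) (spow r)).
  by apply: cvgB; [exact: cvg_id|exact: cvg_cst].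
exact: continuous_spow.
Qed.

(** The balance is nonpositive to the left of all the [a i] and nonnegative to their
right, so the intermediate value theorem applies. *)
Lemma exists_balanced a : exists x, balance W r a x = 0.
Proof.
pose B := \sum_i `|a i|.
have aB i : `|a i| <= B.
  by rewrite /B (bigD1 i) //= lerDl sumr_ge0.
have B0 : 0 <= B by rewrite sumr_ge0.
have z0 : balance W r (fun=> 0) 0 = 0.
  by rewrite /balance big1 // => i _; rewrite subr0 spow0 mulr0.
have lo : balance W r a (- B) <= 0.
  by rewrite -z0; apply: balance_ge => i _; move: (aB i); rewrite ler_norml; lra.
have hi : 0 <= balance W r a B.
  by rewrite -z0; apply: balance_ge => i _; move: (aB i); rewrite ler_norml; lra.
have BB : - B <= B by lra.
have /(IVT BB) : {within `[- B, B], continuous (balance W r a)}.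
  exact/continuous_subspaceT/continuous_balance.
case/(_ 0); last by move=> x _ <-; exists x.
by rewrite ge_min lo le_max hi orbT.
Qed.

Lemma balance_pmean a : balance W r a (pmean W r a) = 0.
Proof.
by rewrite /pmean; case: xgetP => // h; case: (exists_balanced a) => x /h.
Qed.

Lemma pmean_unique a x : balance W r a x = 0 -> x = pmean W r a.
Proof.
move=> hx; have hm := balance_pmean a; apply/eqP; rewrite eq_le !leNgt.
by apply/andP; split; apply/negP => /balance_lt => /(_ a); rewrite hx hm ltxx.
Qed.

(** The balance for [b], which is increasing, is already nonnegative at the point
[pmean W r a + d]. *)
Lemma pmean_le_add a b d :
  (forall i, 0 < W i -> b i <= a i + d) -> pmean W r b <= pmean W r a + d.
Proof.
move=> h; rewrite leNgt; apply/negP => /balance_lt => /(_ b).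
rewrite balance_pmean ltNge -(balance_pmean a); apply/negP/negPn.
by apply: balance_ge => i /h; lra.
Qed.

Lemma pmean_dist a b d :
  (forall i, 0 < W i -> `|a i - b i| <= d) -> `|pmean W r a - pmean W r b| <= d.
Proof.
move=> h; rewrite ler_distl; apply/andP; split.
  rewrite lerBlDr; apply: pmean_le_add => i /h.
  by rewrite ler_norml; lra.
by apply: pmean_le_add => i /h; rewrite ler_norml; lra.
Qed.

Lemma pmean0 : pmean W r (fun=> 0) = 0.
Proof.
apply/esym/pmean_unique; rewrite /balance big1 // => i _.
by rewrite subr0 spow0 mulr0.
Qed.

End Weights.
End PMean.

(** * Nonlinear means along differentiable curves *)

(** Turns an increment into an exact product with a continuous factor, which can be
summed and divided without handling remainders. *)
Lemma caratheodory_slope (R : realType) (f : R -> R) (s d : R) :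
  is_derive s 1 f d ->
  exists q : R -> R, [/\ forall x, f x - f s = q x * (x - s),
    {for s, continuous q} & q s = d].
Proof.
move=> fd; exists (fun x => if x == s then d else (f x - f s) / (x - s)).
split; last by rewrite eqxx.
  by move=> x; case: eqVneq => [->|xs]; rewrite ?subrr ?mulr0 // divfK // subr_eq0.
apply/continuous_withinNx; rewrite eqxx; apply/cvgrPdist_lt => e e0.
have : h^-1 *: (f (h *: 1 + s) - f s) @[h --> 0^'] --> d.
  by case: fd => df <-; exact: df.
move=> /cvgrPdist_lt/(_ _ e0)/nbhs_ballP[k k0 kP].
apply/nbhs_ballP; exists k => // x; rewrite /ball /= => xs xneq.
rewrite (negbTE xneq).
have /= := kP (x - s).
rewrite /ball /= sub0r normrN distrC => /(_ xs).
by rewrite subr_eq0 => /(_ xneq); rewrite /GRing.scale /= mulr1 subrK mulrC.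
Qed.

(** The signed power is differentiable away from 0, and also at 0 when its exponent
r + 1 is at least 1.  The slope can vanish only at 0. *)
Lemma spow_slope (R : realType) (r s : R) : -1 < r -> s != 0 \/ 0 <= r ->
  exists q : R -> R, [/\ forall x, spow r x - spow r s = q x * (x - s),
    {for s, continuous q}, 0 <= q s & s != 0 -> 0 < q s].
Proof.
move=> r1; have [-> [//|r0]|s0 _] := eqVneq s 0.
  exists (fun x => `|x| `^ r); split => //.
  - by move=> x; rewrite spow0 !subr0.
  - suff : continuous (fun x : R => `|x| `^ r) by apply.
    move: r0; rewrite le_eqVlt => /predU1P[<-|r0] x.
      by rewrite (_ : (fun x => _) = cst 1) ?powRr0;
        [exact: cvg_cst|apply/funext => y; rewrite powRr0].
    have -> : (fun x : R => `|x| `^ r) = (fun x => `|spow (r - 1) x|).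
      by apply/funext => y; rewrite norm_spow ?subrK //; lra.
    by apply: cvg_norm; apply: continuous_spow; lra.
have [q [qE qc qs]] := caratheodory_slope (is_derive_spow r s0).
have q0 : 0 < q s by rewrite qs mulr_gt0 ?powR_gt0 ?normr_gt0 //; lra.
by exists q; split => //; exact: ltW.
Qed.

Section PMeanAlongCurve.
Context {R : realType} {I : finType} {T : Type}.
Context {F : set_system T} {FF : ProperFilter F}.
Variables (W : I -> R) (r : R).
Hypotheses (r_gt : -1 < r) (W_ge0 : forall i, 0 <= W i).
Hypothesis W_gt0 : exists i, 0 < W i.
Variables (k : T -> R) (a : T -> I -> R) (a0 v : I -> R).
Hypothesis k_cvg0 : k t @[t --> F] --> 0.
Hypothesis k_neq0 : \forall t \near F, k t != 0.
Hypothesis a_cvg : forall i, (a t i - a0 i) / k t @[t --> F] --> v i.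

Let z t : R := pmean W r (a t).
Let z0 : R := pmean W r a0.
Let s i : R := z0 - a0 i.

(** The increment is the product of [k], which tends to 0, and of a convergent
quotient. *)
Lemma cvg_curve i : a t i @[t --> F] --> a0 i.
Proof.
apply: cvg_trans (_ : k t * ((a t i - a0 i) / k t) + a0 i @[t --> F] --> _).
  apply: near_eq_cvg; near=> t.
  by rewrite mulrC divfK ?subrK //; near: t.
rewrite -[X in _ --> X]add0r -(mul0r (v i)); apply: cvgD; last exact: cvg_cst.
exact: cvgM.
Unshelve. all: by end_near. Qed.

Lemma pmean_curve_dist t : `|z t - z0| <= \sum_i `|a t i - a0 i|.
Proof.
by apply: pmean_dist => // i _; rewrite (bigD1 i) //= lerDl sumr_ge0.
Qed.

Lemma cvg_pmean_curve : z t @[t --> F] --> z0.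
Proof.
have S0 : \sum_i `|a t i - a0 i| @[t --> F] --> 0.
  rewrite [X in _ --> X](_ : 0 = \sum_i `|a0 i - a0 i|); last first.
    by rewrite big1 // => i _; rewrite subrr normr0.
  apply: cvg_sumr => i _; apply: cvg_norm; apply: cvgB; last exact: cvg_cst.
  exact: cvg_curve.
apply/subr_cvg0/cvgr0Pnorm_lt => e e0; near=> t.
apply: le_lt_trans (pmean_curve_dist t) _.
by near: t; exact: (cvgr_lt _ S0).
Unshelve. all: by end_near. Qed.

(** Both balances vanish, so the increments of the forces cancel.  The slope of the
mean is read off from this identity. *)
Lemma balance_increment t :
  \sum_i W i * (spow r (z t - a t i) - spow r (s i)) = 0.
Proof.
under eq_bigr do rewrite mulrBr.
rewrite sumrB -/(balance W r (a t) (z t)) -/(balance W r a0 z0).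
by rewrite !balance_pmean // subrr.
Qed.

Lemma cvg_gap i : z t - a t i @[t --> F] --> s i.
Proof. by apply: cvgB; [exact: cvg_pmean_curve|exact: cvg_curve]. Qed.

(** When every force is differentiable at its tension [s i] and some tension is
nonzero, the increments have the form q_i (dz - da_i) with q_i continuous.  The
sum of the W_i q_i has a positive limit, so dz is a quotient of convergent
sums: this is implicit differentiation. *)
Lemma pmean_curve_slope_regular :
  (forall i, 0 < W i -> s i != 0 \/ 0 <= r) ->
  (exists i, 0 < W i /\ s i != 0) ->
  exists l : R, (z t - z0) / k t @[t --> F] --> l.
Proof.
move=> reg [j [Wj sj]].
have /choice[q qP] : forall i, exists q : R -> R, 0 < W i ->
    [/\ forall x, spow r x - spow r (s i) = q x * (x - s i),
    {for s i, continuous q}, 0 <= q (s i) & s i != 0 -> 0 < q (s i)].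
  move=> i; case: (ltP 0 (W i)) => [Wi|_]; last by exists (fun=> 0).
  by have [q ?] := spow_slope r_gt (reg i Wi); exists q.
have qcvg i : W i * q i (z t - a t i) @[t --> F] --> W i * q i (s i).
  have := W_ge0 i; rewrite le_eqVlt => /predU1P[<-|Wi].
    by under eq_cvg do rewrite mul0r; rewrite mul0r; exact: cvg_cst.
  apply: cvgMr; have [_ qc _ _] := qP i Wi.
  exact: (continuous_cvg _ qc (@cvg_gap i)).
pose Q t := \sum_i W i * q i (z t - a t i).
pose Q0 := \sum_i W i * q i (s i).
have QQ0 : Q t @[t --> F] --> Q0 by apply: cvg_sumr => i _; exact: qcvg.
have Wq0 i : 0 <= W i * q i (s i).
  have := W_ge0 i; rewrite le_eqVlt => /predU1P[<-|Wi]; first by rewrite mul0r.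
  by have [_ _ ? _] := qP i Wi; rewrite mulr_ge0.
have Q0_gt0 : 0 < Q0.
  rewrite /Q0 (bigD1 j) //= ltr_pwDl ?sumr_ge0 //.
  by have [_ _ _ /(_ sj) ?] := qP j Wj; rewrite mulr_gt0.
exists ((\sum_i W i * q i (s i) * v i) / Q0).
have num : \sum_i W i * q i (z t - a t i) * ((a t i - a0 i) / k t) @[t --> F]
    --> \sum_i W i * q i (s i) * v i.
  by apply: cvg_sumr => i _; apply: cvgM; [exact: qcvg|exact: a_cvg].
apply: cvg_trans (cvgM num (cvgV (lt0r_neq0 Q0_gt0) QQ0)).
apply: near_eq_cvg; near=> t.
have Qt : 0 < Q t by near: t; exact: (cvgr_gt _ QQ0).
have kt : k t != 0 by near: t.
apply/eqP; rewrite /= eqr_div ?(lt0r_neq0 Qt) //; apply/eqP.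
rewrite mulr_suml; under eq_bigr do rewrite -(mulrA (W _ * _)) divfK //.
rewrite /Q mulr_sumr; apply/eqP; rewrite -subr_eq0 -sumrB.
rewrite -oppr_eq0 -sumrN -[X in _ == X](balance_increment t); apply/eqP.
apply: eq_bigr => i _; have := W_ge0 i.
rewrite le_eqVlt => /predU1P[<-|Wi]; first by rewrite !mul0r mulr0 subrr oppr0.
by have [-> _ _ _] := qP i Wi; rewrite /s; ring.
Unshelve. all: by end_near. Qed.

(** Here the springs at rest ([s i = 0]) dominate, because near 0 a signed power of
exponent smaller than 1 outweighs every differentiable one, or because no other
spring acts.  Dividing the balance by [spow r (k t)] shows that the slope of the
mean nearly balances the slopes [v i] of the springs at rest, with an error
[rho t] that tends to 0; hence it converges to their mean, by monotonicity. *)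
Lemma pmean_curve_slope_singular :
  (exists i, 0 < W i /\ s i = 0) ->
  (forall i, 0 < W i -> s i != 0 -> r < 0) ->
  exists l : R, (z t - z0) / k t @[t --> F] --> l.
Proof.
move=> [j [Wj sj]] sing.
(* W' keeps the springs at rest, and zt is the difference quotient of the mean. *)
pose W' i := if s i == 0 then W i else 0.
pose vt t i := (a t i - a0 i) / k t.
pose zt t := (z t - z0) / k t.
have W'_ge0 i : 0 <= W' i by rewrite /W'; case: ifP.
have W'_gt0 : exists i, 0 < W' i by exists j; rewrite /W' sj eqxx.
pose rho t := \sum_(i | s i != 0)
  W i * ((spow r (z t - a t i) - spow r (s i)) / spow r (k t)).
have balE : \forall t \near F, balance W' r (vt t) (zt t) = - rho t.
  near=> t; have kt : k t != 0 by near: t.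
  apply/eqP; rewrite -addr_eq0; apply/eqP.
  rewrite -[RHS](mul0r (spow r (k t))^-1) -(balance_increment t) mulr_suml.
  rewrite [RHS](bigID (fun i => s i == 0)) /=; congr (_ + _); last first.
    by apply: eq_bigr => i _; rewrite mulrA.
  rewrite /balance big_mkcond [RHS]big_mkcond; apply: eq_bigr => i _.
  rewrite /W'; case: eqP => [si|]; last by rewrite mul0r.
  rewrite -mulrA; congr (_ * _); rewrite si spow0 subr0.
  have -> : z t - a t i = (zt t - vt t i) * k t.
    have : z0 - a0 i = 0 by [].
    by rewrite mulrBl !divfK // => si'; lra.
  by rewrite spowM mulfK // spow_eq0.
have rho_cvg0 : rho t @[t --> F] --> 0.
  rewrite [X in _ --> X](_ : 0 = \sum_(i | s i != 0) (0 : R)); last by rewrite big1.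
  apply: cvg_sumr => i si.
  have := W_ge0 i; rewrite le_eqVlt => /predU1P[<-|Wi].
    by under eq_cvg do rewrite mul0r; exact: cvg_cst.
  have r0 := sing i Wi si.
  have [q [qE qc _ _]] := spow_slope r_gt (or_introl si : s i != 0 \/ 0 <= r).
  pose M t := `|q (z t - a t i)| * (\sum_j0 `|vt t j0| + `|vt t i|).
  have M_cvg : M t @[t --> F] --> `|q (s i)| * (\sum_j0 `|v j0| + `|v i|).
    apply: cvgM; first by apply: cvg_norm; exact: (continuous_cvg _ qc (@cvg_gap i)).
    by apply: cvgD; [apply: cvg_sumr => j0 _|]; apply: cvg_norm; exact: a_cvg.
  (* Each increment is O(k) while spow r (k t) has size |k|^(r + 1) with r < 0. *)
  have k_pow : `|k t| `^ (- r) @[t --> F] --> 0.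
    have c : continuous (fun x : R => `|x| `^ (- r)).
      have -> : (fun x : R => `|x| `^ (- r)) = (fun x => `|spow (- r - 1) x|).
        by apply/funext => y; rewrite norm_spow ?subrK //; lra.
      by move=> y; apply: cvg_norm; apply: continuous_spow; lra.
    have := continuous_cvg _ (c 0) k_cvg0.
    rewrite normr0 powR0; last by rewrite lt0r_neq0 // oppr_gt0.
    exact.
  have up : W i * (M t * `|k t| `^ (- r)) @[t --> F] --> 0.
    rewrite [X in _ --> X](_ : 0 = W i * (`|q (s i)| * (\sum_j0 `|v j0| + `|v i|) * 0)).
      by apply: cvgMr; exact: cvgM.
    by rewrite !mulr0.
  apply/cvgr0Pnorm_lt => e e0; near=> t.
  have kt : k t != 0 by near: t.
  apply: (@le_lt_trans _ _ (W i * (M t * `|k t| `^ (- r)))); last first.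
    by near: t; exact: (cvgr_lt _ up).
  rewrite qE normrM ger0_norm // ler_wpM2l // normrM normrM normfV norm_spow //.
  rewrite powRD; last by rewrite normr_eq0 kt implybT.
  rewrite powRr1 // powRN invfM !mulrA [leLHS]mulrAC ler_wpM2r ?invr_ge0 ?powR_ge0 //.
  rewrite /M -!mulrA ler_wpM2l //.
  rewrite ler_pdivrMr ?normr_gt0 // mulrDl mulr_suml.
  under eq_bigr do rewrite -normrM divfK //.
  rewrite -normrM divfK // /s.
  have -> : z t - a t i - (z0 - a0 i) = (z t - z0) - (a t i - a0 i) by ring.
  apply: le_trans (ler_normB _ _) _; rewrite lerD2r.
  exact: pmean_curve_dist.
pose m := pmean W' r v.
have bal_cvg x : balance W' r (vt t) x @[t --> F] --> balance W' r v x.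
  apply: cvg_sumr => i _; apply: cvgMr.
  apply: (continuous_cvg _ (continuous_spow r_gt (x := _))).
  by apply: cvgB; [exact: cvg_cst|exact: a_cvg].
have m0 : balance W' r v m = 0 by exact: balance_pmean.
have Nrho : - rho t @[t --> F] --> 0 by rewrite -oppr0; exact: cvgN.
exists m; apply/cvgrPdist_lt => e e0.
have hi : 0 < balance W' r v (m + e).
  by rewrite -m0 balance_lt // ltrDl.
have lo : balance W' r v (m - e) < 0.
  by rewrite -m0 balance_lt // gtrBl.
near=> t.
have bt : balance W' r (vt t) (zt t) = - rho t by near: t.
rewrite distrC ltr_distl; apply/andP; split.
  apply: (@balance_lt_inv _ _ W' r r_gt W'_ge0 (vt t)); rewrite bt.
  apply: (@lt_trans _ _ (balance W' r v (m - e) / 2)).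
    by near: t; apply: (cvgr_lt _ (bal_cvg _)); lra.
  by near: t; apply: (cvgr_gt _ Nrho); lra.
apply: (@balance_lt_inv _ _ W' r r_gt W'_ge0 (vt t)); rewrite bt.
apply: (@lt_trans _ _ (balance W' r v (m + e) / 2)).
  by near: t; apply: (cvgr_lt _ Nrho); lra.
by near: t; apply: (cvgr_gt _ (bal_cvg _)); lra.
Unshelve. all: by end_near. Qed.

(** The regular and the singular case are exhaustive: the former fails only if a
spring at rest has r < 0, or if all springs are at rest. *)
Lemma pmean_curve_slope :
  exists l : R, (z t - z0) / k t @[t --> F] --> l.
Proof.
have [reg|/existsNP[i /not_implyP[Wi /not_orP[/negP/negPn/eqP si /negP r0]]]] :=
  pselect (forall i, 0 < W i -> s i != 0 \/ 0 <= r); last first.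
  apply: pmean_curve_slope_singular; first by exists i.
  by rewrite -ltNge in r0.
have [|/forallNP none] := pselect (exists i, 0 < W i /\ s i != 0).
  exact: pmean_curve_slope_regular.
have all0 i : 0 < W i -> s i = 0.
  by move=> Wi; apply/eqP/negPn/negP => si; exact: (none i).
apply: pmean_curve_slope_singular.
  by case: W_gt0 => i Wi; exists i; rewrite all0.
by move=> i /all0 ->; rewrite eqxx.
Qed.

End PMeanAlongCurve.

(** * Peano existence theorem *)

(** Continuity for the sup norm in a form that is uniform in the output coordinate. *)
Definition continuous_field (R : realType) (V : finType)
    (f : (V -> R) -> V -> R) : Prop :=
  forall (a : V -> R) (e : R), 0 < e -> exists2 d : R, 0 < d &
    forall b, (forall y, `|b y - a y| <= d) -> forall x, `|f b x - f a x| <= e.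

(** Compactness of segments: along an ultrafilter no subsequence is needed, and the
same ultrafilter serves all bounded sequences at once. *)
Lemma ultra_cvg_bounded (R : realType) (G : set_system nat) (g : nat -> R) (B : R) :
  UltraFilter G -> (forall n, `|g n| <= B) -> exists l : R, g n @[n --> G] --> l.
Proof.
move=> GU gB.
have : (g @ G) (`[- B, B]%classic).
  suff sub : [set: nat] `<=` g @^-1` `[- B, B]%classic.
    exact: filterS sub filterT.
  by move=> n _; rewrite /= in_itv /= -ler_norml gB.
move=> /(@segment_compact _ (- B) B _ (fmap_proper_filter g ultra_proper)).
move=> [l [_ cl]]; exists l => A Al /=.
have [//|GnA] := in_ultra_setVsetC (g @^-1` A) GU.
have nA : (g @ G) (~` A) by [].
by have [x [? ?]] := cl _ _ nA Al.
Qed.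

Section EulerPolygons.
Context {R : realType} {V : finType}.
Variables (f : (V -> R) -> V -> R) (M : R) (a0 : V -> R).
Hypothesis f_bounded : forall a x, `|f a x| <= M.

Definition euler (h : R) (k : nat) : V -> R :=
  iter k (fun a x => a x + h * f a x) a0.

(** Over consecutive steps the polygon moves with a velocity that is an average of
the values of [f] at its nodes. *)
Lemma euler_increment h i j x c e : 0 <= h -> (i <= j)%N ->
  (forall k, (i <= k < j)%N -> `|f (euler h k) x - c| <= e) ->
  `|euler h j x - euler h i x - (j%:R * h - i%:R * h) * c|
    <= (j%:R * h - i%:R * h) * e.
Proof.
move=> h0; elim: j => [|j IH].
  by rewrite leqn0 => /eqP -> _; rewrite !subrr !mul0r subrr normr0.
rewrite leq_eqVlt => /predU1P[-> _|]; first by rewrite !subrr !mul0r subrr normr0.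
rewrite ltnS => ij ce.
have {}IH := IH ij.
have -> : euler h j.+1 x - euler h i x - (j.+1%:R * h - i%:R * h) * c
  = (euler h j x - euler h i x - (j%:R * h - i%:R * h) * c)
    + h * (f (euler h j) x - c).
  by rewrite /euler iterS -/(euler h j) -natr1; ring.
have -> : (j.+1%:R * h - i%:R * h) * e = (j%:R * h - i%:R * h) * e + h * e.
  by rewrite -natr1; ring.
apply: le_trans (ler_normD _ _) (lerD _ _).
  by apply: IH => k /andP[ik kj]; apply: ce; rewrite ik ltnS ltnW.
by rewrite normrM ger0_norm // ler_wpM2l // ce // ij /=.
Qed.

Lemma euler_dist h i j x : 0 <= h ->
  `|euler h j x - euler h i x| <= M * `|j%:R * h - i%:R * h|.
Proof.
move=> h0; wlog ij : i j / (i <= j)%N => [wl|].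
  by case/orP: (leq_total i j) => /wl //; rewrite distrC (distrC (j%:R * h)).
have := @euler_increment h i j x 0 M h0 ij.
rewrite mulr0 subr0 => H; rewrite (ger0_norm (_ : 0 <= j%:R * h - i%:R * h)).
  by rewrite mulrC; apply: H => k _; rewrite subr0.
by rewrite subr_ge0 ler_wpM2r // ler_nat.
Qed.

Lemma euler_increment_sym h i j x c e : 0 <= h ->
  (forall k, (minn i j <= k <= maxn i j)%N -> `|f (euler h k) x - c| <= e) ->
  `|euler h j x - euler h i x - (j%:R * h - i%:R * h) * c|
    <= e * `|j%:R * h - i%:R * h|.
Proof.
move=> h0; wlog ij : i j / (i <= j)%N => [wl|].
  case/orP: (leq_total i j) => [/wl //|ji H].
  rewrite -[leLHS]normrN (distrC (j%:R * h)).
  have -> : - (euler h j x - euler h i x - (j%:R * h - i%:R * h) * c) =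
    euler h i x - euler h j x - (i%:R * h - j%:R * h) * c by ring.
  by apply: wl => // k; rewrite minnC maxnC; exact: H.
move=> H; rewrite (ger0_norm (_ : 0 <= j%:R * h - i%:R * h)); last first.
  by rewrite subr_ge0 ler_wpM2r // ler_nat.
rewrite (mulrC e); apply: euler_increment => // k /andP[ik kj].
by apply: H; rewrite (minn_idPl ij) (maxn_idPr ij) ik ltnW.
Qed.

End EulerPolygons.

Section Peano.
Context {R : realType} {V : finType}.
Variables (f : (V -> R) -> V -> R) (M : R) (a0 : V -> R).
Hypotheses (f_bounded : forall a x, `|f a x| <= M) (f_cont : continuous_field f).

Let h n : R := n.+1%:R^-1.
Let idx n (t : R) := Num.truncn (t * n.+1%:R).

Lemma step_ge0 n : 0 <= h n.
Proof. by rewrite invr_ge0. Qed.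

Lemma grid_dist n t : 0 <= t -> `|(idx n t)%:R * h n - t| <= h n.
Proof.
move=> t0; have n0 : 0 < n.+1%:R :> R by rewrite ltr0n.
have /andP[lo hi] := truncn_itv (mulr_ge0 t0 (ltW n0)).
rewrite -(ler_pM2r n0) -[X in _ * X <= _](gtr0_norm n0) -normrM mulrBl /h.
rewrite mulfVK ?gt_eqF // mulVf ?gt_eqF // ler_norml.
move: lo hi; rewrite -/(idx n t) -natr1; set i := (idx n t)%:R.
by set y := t * _ => lo hi; apply/andP; split; lra.
Qed.

Lemma cvg_grid (G : set_system nat) {GF : Filter G} t : \oo `<=` G -> 0 <= t ->
  (idx n t)%:R * h n @[n --> G] --> t.
Proof.
move=> ooG t0; apply/cvgrPdist_le => e e0.
have /cvgr0Pnorm_le/(_ _ e0)/ooG := @cvg_harmonic R.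
apply: filterS => n hn; rewrite distrC; apply: le_trans (grid_dist n t0) _.
exact: le_trans (ler_norm _) hn.
Qed.

(** The solution is the limit, along one ultrafilter, of the Euler polygons of step
1 / (n + 1).  Near time [t] all nodes are close to [U t], by the bound on the
speed, so by continuity of [f] the increments of the polygons are close to those
of slope [f (U t)] uniformly in [n], and the estimate passes to the limit.  This
uses neither integrals nor a selection of uniformly convergent subsequences. *)
Lemma peano_existence : exists U : R -> V -> R,
  [/\ forall x, U 0 x = a0 x,
      forall t x, 0 <= t -> `|U t x - a0 x| <= M * t
    & forall t x e, 0 <= t -> 0 < e -> exists2 d, 0 < d &
        forall s, 0 <= s -> `|s - t| < d ->
          `|U s x - U t x - (s - t) * f (U t) x| <= e * `|s - t|].
Proof.
(* A free ultrafilter: limits along oo are limits along G. *)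
have [G [GU ooG]] := ultraFilterLemma (@eventually_filter).
have GP : ProperFilter G by exact: ultra_proper.
pose X n t := euler f a0 (h n) (idx n t).
have Xdist n s t x : `|X n s x - X n t x| <= M * `|(idx n s)%:R * h n - (idx n t)%:R * h n|.
  exact: (euler_dist a0 f_bounded _ _ _ (step_ge0 n)).
have idx0 n : idx n 0 = 0%N by rewrite /idx mul0r truncn0.
have X0 n x : X n 0 x = a0 x by rewrite /X idx0.
have M0 (x : V) : 0 <= M by exact: (le_trans (normr_ge0 (f a0 x)) (f_bounded a0 x)).
have /choice[U UP] : forall tx : R * V, exists l : R, 0 <= tx.1 ->
    X n tx.1 tx.2 @[n --> G] --> l.
  case=> t x /=; case: (leP 0 t) => [t0|_]; last by exists 0.
  have [n|l lP] := @ultra_cvg_bounded R G (fun n => X n t x) (`|a0 x| + M * (t + 1)) GU.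
    have := Xdist n t 0 x; rewrite idx0 mul0r subr0 X0 => H.
    rewrite -(subrK (a0 x) (X n t x)) addrC; apply: le_trans (ler_normD _ _) _.
    rewrite lerD2l; apply: le_trans H _; rewrite ler_wpM2l ?(M0 x) //.
    have hn1 : h n <= 1 by rewrite invf_le1 ?ltr0n // ler1n.
    have := grid_dist n t0; rewrite ler_distl => /andP[_ H'].
    rewrite ger0_norm; last by rewrite mulr_ge0 // step_ge0.
    by apply: le_trans H' _; rewrite lerD2l.
  by exists l.
have {}UP t x : 0 <= t -> X n t x @[n --> G] --> U (t, x) by exact: UP (t, x).
pose u t x := U (t, x).
exists u; split.
- move=> x; have := UP 0 x (lexx 0); under eq_cvg do rewrite X0.
  by move=> /(cvg_unique (@norm_hausdorff _ _)); apply; exact: cvg_cst.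
- move=> t x t0; apply: (@ler_cvg_to _ G _ _ (fun n => `|X n t x - a0 x|)
    (fun n => M * `|(idx n t)%:R * h n - 0|)).
  + by apply: cvg_norm; apply: cvgB; [exact: UP|exact: cvg_cst].
  + rewrite -[in X in _ --> X](ger0_norm t0) -[in X in _ --> X](subr0 t).
    apply: cvgMr; apply: cvg_norm; apply: cvgB; last exact: cvg_cst.
    exact: cvg_grid.
  + by near=> n; have := Xdist n t 0 x; rewrite idx0 mul0r X0.
move=> t x e t0 e0.
have [d d0 dP] := f_cont (u t) e0.
have {M0} Mx0 := M0 x.
(* With d1 as time window and as bound on the step, the nodes concerned are within
3 * M * d1 of the node at time t, which is itself within d / 3 of U t. *)
pose d1 := d / (5 * (M + 1)).
have d1_gt0 : 0 < d1 by rewrite divr_gt0 // mulr_gt0 //; lra.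
have Md1 : M * d1 <= d / 5.
  have : d1 * (M + 1) = d / 5.
    by rewrite /d1; field; lra.
  by nra.
exists d1 => // s s0 st.
apply: (@ler_cvg_to _ G _ _
  (fun n => `|X n s x - X n t x
     - ((idx n s)%:R * h n - (idx n t)%:R * h n) * f (u t) x|)
  (fun n => e * `|(idx n s)%:R * h n - (idx n t)%:R * h n|)).
- apply: cvg_norm; apply: cvgB; first by apply: cvgB; exact: UP.
  by apply: cvgM; [apply: cvgB; exact: cvg_grid|exact: cvg_cst].
- by apply: cvgMr; apply: cvg_norm; apply: cvgB; exact: cvg_grid.
have near_step : \forall n \near G, h n <= d1.
  have /cvgr0Pnorm_le/(_ _ d1_gt0)/ooG := @cvg_harmonic R.
  by apply: filterS => n; apply: le_trans; exact: ler_norm.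
have near_X : \forall n \near G, forall y, `|X n t y - u t y| <= d / 3.
  apply: filter_forall => y; have d3 : 0 < d / 3 by rewrite divr_gt0.
  have /cvgrPdist_le/(_ _ d3) := UP t y t0.
  by apply: filterS => n; rewrite distrC.
near=> n; apply: euler_increment_sym; first exact: step_ge0.
have Xn : forall y, `|X n t y - u t y| <= d / 3 by near: n.
move=> k kst; apply: dP => y.
have hn : h n <= d1 by near: n.
have {}Xn := Xn y.
have st_grid : `|k%:R * h n - (idx n t)%:R * h n| <= d1 + d1 + d1.
  apply: (@le_trans _ _ `|(idx n s)%:R * h n - (idx n t)%:R * h n|); last first.
    have -> : (idx n s)%:R * h n - (idx n t)%:R * h n
      = ((idx n s)%:R * h n - s) + (s - t) - ((idx n t)%:R * h n - t) by ring.
    apply: le_trans (ler_normB _ _) (lerD _ (le_trans (grid_dist n t0) hn)).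
    exact: le_trans (ler_normD _ _) (lerD (le_trans (grid_dist n s0) hn) (ltW st)).
  rewrite -!mulrBl !normrM ler_wpM2r //.
  move: kst; case/orP: (leq_total (idx n s) (idx n t)) => ij.
    rewrite (minn_idPr ij) (maxn_idPl ij) => /andP[ik kj].
    by rewrite !ler0_norm ?subr_le0 ?ler_nat // lerN2 lerD2r ler_nat.
  rewrite (minn_idPl ij) (maxn_idPr ij) => /andP[ik kj].
  by rewrite !ger0_norm ?subr_ge0 ?ler_nat // lerD2r ler_nat.
have Xk : `|euler f a0 (h n) k y - X n t y| <= _ :=
  euler_dist a0 f_bounded (idx n t) k y (step_ge0 n).
rewrite -(subrK (X n t y) (euler _ _ _ k y)) -addrA.
apply: le_trans (ler_normD _ _) _.
have : M * `|k%:R * h n - (idx n t)%:R * h n| <= M * (d1 + d1 + d1) by rewrite ler_wpM2l.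
by lra.
Unshelve. all: by end_near. Qed.

End Peano.

(** * Boundary values and summation by parts *)

Lemma gt1_sub2 (R : realType) (p : R) : 1 < p -> -1 < p - 2.
Proof. by move=> ?; lra. Qed.

Section DomainLemmas.
Context {R : realType} {V : finType} (G : network R V) (S : {set V}).
Variables (p : R) (mu sigma : V -> R).
Hypothesis p_gt1 : 1 < p.
Hypothesis mu_ge0 : forall z, z \in boundary G S -> 0 <= mu z.
Hypothesis sigma_ge0 : forall z, z \in boundary G S -> 0 <= sigma z.
Hypothesis mu_sigma_gt0 : forall z, z \in boundary G S -> 0 < mu z + sigma z.

Let D := closed_dom G S.
Let w := dom_weight G S.

Let p2_gt : -1 < p - 2 := gt1_sub2 p_gt1.

Lemma boundaryP z : z \in boundary G S ->
  z \notin S /\ exists2 y, y \in S & adj G y z.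
Proof.
by rewrite inE => /andP[zS /existsP[y /andP[yS yz]]]; split => //; exists y.
Qed.

Lemma dom_weight_ge0 x y : 0 <= w x y.
Proof. by rewrite /w /dom_weight; case: ifP => // _; exact: weight_ge0. Qed.

Lemma dom_weight_sym x y : w x y = w y x.
Proof. by rewrite /w /dom_weight orbC weight_sym. Qed.

Lemma dom_weight_gt0 x y : x \in S -> adj G x y -> 0 < w x y.
Proof. by move=> xS xy; rewrite /w /dom_weight xS /= weight_gt0. Qed.

Lemma sub_closed_dom x : x \in S -> x \in D.
Proof. by move=> xS; rewrite inE xS. Qed.

Lemma boundary_closed_dom z : z \in boundary G S -> z \in D.
Proof. by move=> zB; rewrite inE zB orbT. Qed.

Lemma plaplacianE u x :
  plaplacian G S p u x = \sum_(y in D) spow (p - 2) (u y - u x) * w x y.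
Proof. by apply: eq_bigr => y _; rewrite /spow distrC. Qed.

Definition boundary_condition (u : V -> R) (z : V) : Prop :=
  mu z * pnormal_derivative G S p u z + sigma z * spow (p - 2) (u z) = 0.

(** The springs acting on a boundary vertex [z]: those of its edges, scaled by [mu z],
and one of strength [sigma z] tied to the position 0.  The latter is attached to
the index [z] itself, at which [inner_part] is 0. *)
Definition trace_weight (z y : V) : R :=
  if y \in S then mu z * w z y else if y == z then sigma z else 0.

Definition inner_part (a : V -> R) (y : V) : R := if y \in S then a y else 0.

Definition extension (a : V -> R) (x : V) : R :=
  if x \in S then a x else pmean (trace_weight x) (p - 2) (inner_part a).

Lemma trace_weight_ge0 z : z \in boundary G S -> forall y, 0 <= trace_weight z y.
Proof.
move=> zB y; rewrite /trace_weight; case: ifP => _.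
  by rewrite mulr_ge0 ?mu_ge0 // dom_weight_ge0.
by case: ifP => // _; exact: sigma_ge0.
Qed.

Lemma trace_weight_gt0 z : z \in boundary G S -> exists y, 0 < trace_weight z y.
Proof.
move=> zB; have [zS [y yS yz]] := boundaryP zB.
have := mu_ge0 zB; rewrite le_eqVlt => /predU1P[mu0|mu_gt0].
  exists z; rewrite /trace_weight (negbTE zS) eqxx.
  by have := mu_sigma_gt0 zB; rewrite -mu0 add0r.
exists y; rewrite /trace_weight yS mulr_gt0 // dom_weight_sym.
exact: dom_weight_gt0.
Qed.

(** The boundary condition at [z] is a balance, so that [pmean] solves it. *)
Lemma balance_trace z u : z \in boundary G S ->
  balance (trace_weight z) (p - 2) (inner_part u) (u z)
  = mu z * pnormal_derivative G S p u z + sigma z * spow (p - 2) (u z).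
Proof.
move=> zB; have [zS _] := boundaryP zB.
rewrite /balance (bigID (mem S)) /=; congr (_ + _).
  rewrite /pnormal_derivative mulr_sumr; apply: eq_bigr => y yS.
  rewrite /trace_weight /inner_part yS /spow -/(w z y).
  by rewrite -!mulrA; congr (_ * _); rewrite mulrC mulrA.
rewrite (bigD1 z) //= big1 ?addr0 => [|y /andP[yS yz]].
  by rewrite /trace_weight /inner_part (negbTE zS) eqxx subr0.
by rewrite /trace_weight (negbTE yS) (negbTE yz) mul0r.
Qed.

Lemma extension_inner a x : x \in S -> extension a x = a x.
Proof. by move=> xS; rewrite /extension xS. Qed.

Lemma eq_inner_part a b : {in S, a =1 b} -> inner_part a = inner_part b.
Proof.
by move=> ab; apply/funext => y; rewrite /inner_part; case: ifP => // /ab.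
Qed.

Lemma eq_extension a b : {in S, a =1 b} -> extension a = extension b.
Proof.
move=> ab; apply/funext => x; rewrite /extension (eq_inner_part ab).
by case: ifP => // /ab.
Qed.

Lemma extension_boundary a z : z \in boundary G S ->
  boundary_condition (extension a) z.
Proof.
move=> zB; have [zS _] := boundaryP zB.
rewrite /boundary_condition -balance_trace //.
have -> : inner_part (extension a) = inner_part a.
  by apply: eq_inner_part => y; exact: extension_inner.
rewrite /extension (negbTE zS).
exact: (balance_pmean p2_gt (trace_weight_ge0 zB)).
Qed.

Lemma extension_unique u : {in boundary G S, forall z, boundary_condition u z} ->
  {in D, u =1 extension u}.
Proof.
move=> bc x; rewrite /extension; case: ifPn => // xS; rewrite inE (negbTE xS) /=.
move=> xB; apply: (pmean_unique p2_gt (trace_weight_ge0 xB) (trace_weight_gt0 xB)).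
by rewrite balance_trace //; exact: bc.
Qed.

Lemma extension_dist a b d x : x \in D -> 0 <= d ->
  (forall y, y \in S -> `|a y - b y| <= d) ->
  `|extension a x - extension b x| <= d.
Proof.
rewrite /extension inE => /orP xD d0 ab; case: ifPn => [/ab //|xS].
case: xD => [xS'|xB]; first by rewrite xS' in xS.
apply: (pmean_dist p2_gt (trace_weight_ge0 xB) (trace_weight_gt0 xB)) => y _.
by rewrite /inner_part; case: ifPn => [/ab //|_]; rewrite subrr normr0.
Qed.

Lemma extension_norm a B x : x \in D -> 0 <= B ->
  (forall y, y \in S -> `|a y| <= B) -> `|extension a x| <= B.
Proof.
move=> xD B0 aB.
have -> : extension a x = extension a x - extension (fun=> 0) x.
  rewrite [X in _ - X]/extension; case: ifPn => [_|xS]; first by rewrite subr0.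
  move: xD; rewrite inE (negbTE xS) /= => xB.
  have -> : inner_part (fun=> 0) = (fun=> 0).
    by apply/funext => y; rewrite /inner_part; case: ifP.
  by rewrite (pmean0 p2_gt (trace_weight_ge0 xB) (trace_weight_gt0 xB)) subr0.
by apply: extension_dist => // y /aB; rewrite subr0.
Qed.

Definition energy (u : V -> R) : R :=
  2^-1 * (\sum_(x in D) \sum_(y in D) `|u x - u y| `^ p * w x y)
  + \sum_(z in Gamma G S mu) sigma z / mu z * `|u z| `^ p.

Lemma Gamma_boundary z : z \in Gamma G S mu -> z \in boundary G S.
Proof. by rewrite inE => /andP[]. Qed.

Lemma energy_term_ge0 (u : V -> R) z : z \in Gamma G S mu ->
  0 <= sigma z / mu z * `|u z| `^ p.
Proof.
move=> zG; have zB := Gamma_boundary zG.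
by rewrite mulr_ge0 ?powR_ge0 // divr_ge0 ?sigma_ge0 ?mu_ge0.
Qed.

Lemma energy_ge0 (u : V -> R) : 0 <= energy u.
Proof.
rewrite addr_ge0 ?sumr_ge0 //; last by move=> z; exact: energy_term_ge0.
rewrite mulr_ge0 // ?invr_ge0 // sumr_ge0 // => x _; rewrite sumr_ge0 // => y _.
by rewrite mulr_ge0 ?powR_ge0 // dom_weight_ge0.
Qed.

(** Swapping the two ends of an edge changes the sign of the flux; adding the two
expressions of the sum leaves the p-energy of the edges. *)
Lemma sum_mul_plaplacian (u : V -> R) :
  \sum_(x in D) u x * plaplacian G S p u x
  = - (2^-1 * \sum_(x in D) \sum_(y in D) `|u x - u y| `^ p * w x y).
Proof.
pose phi x y := spow (p - 2) (u y - u x) * w x y.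
have phiC x y : phi y x = - phi x y.
  by rewrite /phi dom_weight_sym -mulNr -spowN opprB.
have E : \sum_(x in D) u x * plaplacian G S p u x
    = \sum_(x in D) \sum_(y in D) u x * phi x y.
  by apply: eq_bigr => x _; rewrite plaplacianE mulr_sumr.
have E' : \sum_(x in D) u x * plaplacian G S p u x
    = - \sum_(x in D) \sum_(y in D) u y * phi x y.
  rewrite E exchange_big /= -sumrN; apply: eq_bigr => x _.
  by rewrite -sumrN; apply: eq_bigr => y _; rewrite phiC mulrN.
have : \sum_(x in D) u x * plaplacian G S p u x
     + \sum_(x in D) u x * plaplacian G S p u x
   = - \sum_(x in D) \sum_(y in D) `|u x - u y| `^ p * w x y.
  rewrite {1}E E' -sumrB -sumrN; apply: eq_bigr => x _.
  rewrite -sumrB -sumrN; apply: eq_bigr => y _.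
  rewrite -mulrBl /phi mulrA -(opprB (u y)) !mulNr mulr_spow //.
  by rewrite subrK opprB distrC.
by move=> H; lra.
Qed.

(** A boundary vertex has no edge to another boundary vertex in the domain. *)
Lemma plaplacian_boundary u z : z \in boundary G S ->
  plaplacian G S p u z = - pnormal_derivative G S p u z.
Proof.
move=> zB; have [zS _] := boundaryP zB.
rewrite plaplacianE /pnormal_derivative -sumrN (bigID (mem S)) /=.
rewrite [X in _ + X]big1 ?addr0 => [|y /andP[_ yS]]; last first.
  by rewrite /w /dom_weight (negbTE zS) (negbTE yS) mulr0.
apply: eq_big => [y|y yS].
  by rewrite andb_idl // => /sub_closed_dom.
by rewrite -mulNr -mulrN opprB /spow distrC.
Qed.

(** Off [Gamma] the coefficient [mu z] is 0, hence [sigma z] is positive and the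
condition is of Dirichlet type. *)
Lemma boundary_condition_out u z : z \in boundary G S -> boundary_condition u z ->
  z \notin Gamma G S mu -> u z = 0.
Proof.
move=> zB bc; rewrite inE zB /= -leNgt => mu_le0.
have mu0 : mu z = 0 by apply/eqP; rewrite eq_le mu_le0 mu_ge0.
have := mu_sigma_gt0 zB; rewrite mu0 add0r => s0.
move: bc; rewrite /boundary_condition mu0 mul0r add0r => /eqP.
by rewrite mulf_eq0 (gt_eqF s0) /= spow_eq0 => /eqP.
Qed.

(** The boundary terms of the summation by parts are normal derivatives, and the
boundary condition turns them into the [Gamma]-part of the energy. *)
Lemma green_identity u : {in boundary G S, forall z, boundary_condition u z} ->
  \sum_(x in S) u x * plaplacian G S p u x = - energy u.
Proof.
move=> bc; rewrite /energy opprD -sum_mul_plaplacian.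
have DE : \sum_(x in D) u x * plaplacian G S p u x =
    \sum_(x in S) u x * plaplacian G S p u x +
    \sum_(z in boundary G S) u z * plaplacian G S p u z.
  rewrite -bigU /=; first by apply: eq_bigl => x; rewrite !inE.
  rewrite disjoint_subset.
  by apply/fintype.subsetP => x xS; rewrite !inE xS.
rewrite DE -addrA -[LHS]addr0; congr (_ + _); apply/esym/eqP.
rewrite subr_eq0 (bigID (mem (Gamma G S mu))) /=.
rewrite [X in _ + X]big1 ?addr0 => [|z /andP[zB zG]]; last first.
  by rewrite (boundary_condition_out zB (bc z zB) zG) mul0r.
apply/eqP; apply: eq_big => [z|z /andP[zB zG]].
  by rewrite andb_idl // => /Gamma_boundary.
rewrite plaplacian_boundary //.
have mu0 : mu z != 0 by move: zG; rewrite inE => /andP[_ /lt0r_neq0].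
have -> : - pnormal_derivative G S p u z = sigma z / mu z * spow (p - 2) (u z).
  apply: (mulfI mu0); have := bc z zB; rewrite /boundary_condition => /eqP.
  by rewrite addr_eq0 => /eqP H; rewrite mulrN H opprK; field.
by rewrite mulrCA mulr_spow // subrK.
Qed.

End DomainLemmas.

(** * Positivity of the first eigenvalue *)

(** Extracts a bound for [a] from one for its p-th power. *)
Lemma root_le (R : realType) (p c a E : R) : 0 < p -> 0 < c -> 0 <= a ->
  c * a `^ p <= E -> a <= c^-1 `^ p^-1 * E `^ p^-1.
Proof.
move=> p0 c0 a0 h.
have E0 : 0 <= E by apply: le_trans h; rewrite mulr_ge0 ?powR_ge0 // ltW.
rewrite -powRM ?invr_ge0 ?(ltW c0) // -{1}(powRr1 a0) -(divff (lt0r_neq0 p0)) powRrM.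
rewrite ge0_ler_powR ?nnegrE ?invr_ge0 ?powR_ge0 ?mulr_ge0 ?(ltW p0) ?invr_ge0 ?(ltW c0) //.
by rewrite mulrC ler_pdivlMr // mulrC.
Qed.

Section Eigenvalue.
Context {R : realType} {V : finType} (G : network R V) (S : {set V}).
Hypothesis S_connected : connected_in (adj G) S.
Variables (p : R) (mu sigma : V -> R).
Hypothesis p_gt1 : 1 < p.
Hypothesis mu_ge0 : forall z, z \in boundary G S -> 0 <= mu z.
Hypothesis sigma_ge0 : forall z, z \in boundary G S -> 0 <= sigma z.

Let D := closed_dom G S.
Let w := dom_weight G S.
Let E (u : V -> R) := energy G S p mu sigma u.
Let p_gt0 : 0 < p := lt_trans ltr01 p_gt1.

Definition vanishing_off_Gamma (u : V -> R) : Prop :=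
  forall z, z \in boundary G S -> z \notin Gamma G S mu -> u z = 0.

Lemma rayleighE (u : V -> R) :
  rayleigh G S p mu sigma u = E u / \sum_(x in S) `|u x| `^ p.
Proof. by []. Qed.

Lemma sum_norm_ge0 (u : V -> R) : 0 <= \sum_(x in S) `|u x| `^ p.
Proof. by rewrite sumr_ge0 // => x _; exact: powR_ge0. Qed.

Lemma rayleigh_lbound :
  has_lbound [set rayleigh G S p mu sigma u | u in admissible G S mu].
Proof.
exists 0 => _ [u _ <-]; rewrite rayleighE.
by rewrite divr_ge0 ?sum_norm_ge0 //; exact: energy_ge0.
Qed.

Lemma first_eigenvalue_le (u : V -> R) : vanishing_off_Gamma u ->
  first_eigenvalue G S p mu sigma * \sum_(x in S) `|u x| `^ p <= E u.
Proof.
move=> u0; have := sum_norm_ge0 u; rewrite le_eqVlt => /predU1P[<-|s_gt0].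
  by rewrite mulr0; exact: energy_ge0.
rewrite -ler_pdivlMr // -rayleighE; apply: (ge_inf rayleigh_lbound).
exists u => //; split => //; apply: contrapT => no.
move: s_gt0; rewrite big1 ?ltxx // => x xS.
have [ux|ux] := eqVneq (u x) 0; first by rewrite ux normr0 powR0 // gt_eqF.
by exfalso; apply: no; exists x.
Qed.

Lemma edge_le_energy (u : V -> R) x y : x \in D -> y \in D ->
  2^-1 * w x y * `|u x - u y| `^ p <= E u.
Proof.
move=> xD yD; rewrite -mulrA /E /energy -[leLHS]addr0; apply: lerD; last first.
  by rewrite sumr_ge0 // => z; exact: energy_term_ge0.
have t0 a b : 0 <= `|u a - u b| `^ p * w a b.
  by rewrite mulr_ge0 ?powR_ge0 //; exact: dom_weight_ge0.
rewrite ler_wpM2l ?invr_ge0 // (bigD1 x) //= (bigD1 y) //= mulrC -addrA lerDl.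
by rewrite addr_ge0 ?sumr_ge0 // => a _; rewrite sumr_ge0.
Qed.

Let controlled (x : V) := exists2 C : R, 0 <= C &
  forall u, vanishing_off_Gamma u -> `|u x| <= C * E u `^ p^-1.

(** The [Gamma]-term of the energy controls the value where [sigma] is positive; off
[Gamma] the value is 0. *)
Lemma controlled_boundary z : z \in boundary G S -> sigma z != 0 -> controlled z.
Proof.
move=> zB s_neq0; have s_gt0 : 0 < sigma z.
  by rewrite lt_neqAle eq_sym s_neq0 sigma_ge0.
have [zG|zG] := boolP (z \in Gamma G S mu); last first.
  by exists 0 => // u u0; rewrite (u0 z) // normr0 mul0r.
have mu_gt0 : 0 < mu z by move: zG; rewrite inE => /andP[].
exists ((sigma z / mu z)^-1 `^ p^-1); first exact: powR_ge0.
move=> u _; apply: root_le => //; first exact: divr_gt0.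
rewrite /E /energy [X in _ + X](bigD1 z) //= addrCA lerDl addr_ge0 //.
  rewrite mulr_ge0 ?invr_ge0 // sumr_ge0 // => x _; rewrite sumr_ge0 // => y _.
  by rewrite mulr_ge0 ?powR_ge0 //; exact: dom_weight_ge0.
rewrite sumr_ge0 // => y /andP[yG _].
exact: (energy_term_ge0 p mu_ge0 sigma_ge0 u yG).
Qed.

Lemma controlled_edge x y : x \in D -> y \in D -> 0 < w x y ->
  controlled x -> controlled y.
Proof.
move=> xD yD wxy [C C0 CP].
exists (C + (2^-1 * w x y)^-1 `^ p^-1); first by rewrite addr_ge0 ?powR_ge0.
move=> u u0; rewrite -(subrK (u x) (u y)) mulrDl addrC.
apply: le_trans (ler_normD _ _) (lerD (CP u u0) _).
rewrite distrC; apply: root_le => //; first by rewrite mulr_gt0 // invr_gt0.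
exact: edge_le_energy.
Qed.

(** Control passes from a vertex to its neighbours ([controlled_edge]), hence to all
of the connected set [S]. *)
Lemma controlled_inner : (exists2 z, z \in boundary G S & sigma z != 0) ->
  forall x, x \in S -> controlled x.
Proof.
move=> [z zB sz] x xS; have [zS [y yS yz]] := boundaryP zB.
have cy : controlled y.
  apply: (controlled_edge (boundary_closed_dom zB) (sub_closed_dom G yS)).
    by rewrite /w dom_weight_sym dom_weight_gt0.
  exact: controlled_boundary.
case: S_connected => _ /(_ y x yS xS)/connectP[s] + ->.
elim: s y {yz} yS cy => [//|b s IH] y yS cy /= /andP[/and3P[_ bS yb]].
apply: IH => //; apply: (controlled_edge _ _ _ cy); last exact: dom_weight_gt0.
- exact: sub_closed_dom.
- exact: sub_closed_dom.
Qed.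

Lemma poincare_inequality : (exists2 z, z \in boundary G S & sigma z != 0) ->
  exists2 K : R, 0 < K & forall u, vanishing_off_Gamma u ->
    \sum_(x in S) `|u x| `^ p <= K * E u.
Proof.
move=> hs; have /choice[C CP] : forall x : V, exists C : R, 0 <= C /\ (x \in S ->
    forall u, vanishing_off_Gamma u -> `|u x| <= C * E u `^ p^-1).
  move=> x; have [xS|xS] := boolP (x \in S); last by exists 0.
  by have [C C0 CP] := controlled_inner hs xS; exists C.
exists (1 + \sum_(x in S) C x `^ p).
  by apply: ltr_pwDl => //; apply: sumr_ge0 => x _; apply: powR_ge0.
move=> u u0; have E0 : 0 <= E u by exact: energy_ge0.
rewrite mulrDl mul1r ler_wpDl // mulr_suml; apply: ler_sum => x xS.
have [Cx /(_ xS u u0) h] := CP x.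
apply: le_trans (_ : (C x * E u `^ p^-1) `^ p <= _).
  by rewrite ge0_ler_powR ?nnegrE ?(ltW p_gt0) // mulr_ge0 ?powR_ge0.
by rewrite powRM ?powR_ge0 // -powRrM mulVf ?gt_eqF // powRr1.
Qed.

Lemma first_eigenvalue_gt0 : (exists2 z, z \in boundary G S & sigma z != 0) ->
  0 < first_eigenvalue G S p mu sigma.
Proof.
move=> /poincare_inequality[K K0 KP].
apply: lt_le_trans (_ : K^-1 <= _); first by rewrite invr_gt0.
apply: lb_le_inf.
  case: S_connected => /set0Pn[x xS] _.
  exists (rayleigh G S p mu sigma (fun y => (y \in S)%:R)), (fun y => (y \in S)%:R) => //.
  split; first by exists x => //; rewrite xS oner_eq0.
  by move=> z /boundaryP[zS _] _; rewrite (negbTE zS).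
move=> _ [u [[x xS ux] u0] <-]; rewrite rayleighE.
have s_gt0 : 0 < \sum_(x in S) `|u x| `^ p.
  rewrite (bigD1 x) //=; apply: ltr_pwDl; first by rewrite powR_gt0 // normr_gt0.
  by apply: sumr_ge0 => y _; apply: powR_ge0.
by rewrite ler_pdivlMr // mulrC ler_pdivrMr // mulrC KP.
Qed.

End Eigenvalue.

(** * Power sums and absorption of the reaction term *)

Section PowerMeans.
Context {R : realType}.

(** The Young inequality with second factor 1. *)
Lemma bernoulli_powR (x k : R) : 0 <= x -> 1 <= k -> 1 + k * (x - 1) <= x `^ k.
Proof.
move=> x0; rewrite le_eqVlt => /predU1P[<-|k1].
  by rewrite powRr1 // mul1r subrKC.
have k0 : 0 < k by lra.
have k'0 : 0 < 1 - k^-1 by rewrite subr_gt0 invf_lt1.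
have := @conjugate_powR R x 1 k (1 - k^-1)^-1 x0 ler01 k0.
rewrite invr_gt0 invrK => /(_ k'0); rewrite subrKC => /(_ erefl).
rewrite mulr1 powR1 /= => h.
have : k * x <= k * (x `^ k / k + 1 * (1 - k^-1)) by rewrite ler_pM2l.
rewrite mulrDr mulrCA divff ?gt_eqF // mulr1 mul1r mulrBr divff ?gt_eqF //.
by lra.
Qed.

Context {I : finType} (S : {set I}).
Let N : R := #|S|%:R.

(** Each [c i] is at most the whole sum: keep one factor and bound the power k - 1 of
the other one. *)
Lemma sum_powR_le (c : I -> R) (k : R) : (forall i, 0 <= c i) -> 1 <= k ->
  \sum_(i in S) c i `^ k <= (\sum_(i in S) c i) `^ k.
Proof.
move=> c0 k1; have k0 : 0 < k by lra.
have C0 : 0 <= \sum_(i in S) c i by rewrite sumr_ge0.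
rewrite -(mulr_powRB1 C0 k0) mulr_suml; apply: ler_sum => i iS.
rewrite -(mulr_powRB1 (c0 i) k0) ler_wpM2l // ge0_ler_powR ?nnegrE ?subr_ge0 //.
by rewrite (bigD1 i) //= lerDl sumr_ge0.
Qed.

(** The inequality between power means: sum the tangent-line inequality for the k-th
power at the average of the [c i]. *)
Lemma le_sum_powR (c : I -> R) (k : R) : (forall i, 0 <= c i) -> 1 <= k ->
  (\sum_(i in S) c i) `^ k <= N `^ (k - 1) * \sum_(i in S) c i `^ k.
Proof.
move=> c0 k1; have k0 : 0 < k by lra.
have C0 : 0 <= \sum_(i in S) c i by rewrite sumr_ge0.
have P0 : 0 <= \sum_(i in S) c i `^ k.
  by apply: sumr_ge0 => i _; apply: powR_ge0.
move: (C0); rewrite le_eqVlt => /predU1P[<-|C_gt0].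
  by rewrite powR0 ?gt_eqF // mulr_ge0 ?powR_ge0.
have N0 : 0 < N.
  rewrite ltr0n card_gt0; apply/negP => /eqP S0.
  by move: C_gt0; rewrite S0 big_set0 ltxx.
set C := \sum_(i in S) c i in C0 C_gt0 *.
pose m := C / N; have m0 : 0 < m by rewrite divr_gt0.
have tangent i : i \in S -> m `^ k * (1 + k * (c i / m - 1)) <= c i `^ k.
  move=> iS; have := @bernoulli_powR (c i / m) k (divr_ge0 (c0 i) (ltW m0)) k1.
  rewrite -(ler_pM2l (powR_gt0 k m0)) -powRM ?(ltW m0) ?divr_ge0 ?(ltW m0) //.
  by rewrite mulrCA divff ?gt_eqF // mulr1.
have sum_tangent : \sum_(i in S) m `^ k * (1 + k * (c i / m - 1)) = m `^ k * N.
  rewrite -mulr_sumr big_split /= -mulr_sumr sumrB -mulr_suml -/C !sumr_const -/N.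
  by rewrite /m invf_div mulrCA divff ?mulr1 ?subrr ?mulr0 ?addr0 ?gt_eqF.
have h : m `^ k * N <= \sum_(i in S) c i `^ k.
  by rewrite -sum_tangent; apply: ler_sum.
have -> : C `^ k = N `^ (k - 1) * ((C / N) `^ k * N).
  have Nk : N `^ (k - 1) * N = N `^ k by rewrite mulrC mulr_powRB1 // ltW.
  have -> : (C / N) `^ k = C `^ k / N `^ k.
    by rewrite powRM ?invr_ge0 ?(ltW N0) // -(powR_inv1 (ltW N0)) -powRrM mulN1r powRN.
  rewrite -Nk; field; rewrite gt_eqF //=; exact/lt0r_neq0/powR_gt0.
by rewrite ler_wpM2l ?powR_ge0.
Qed.

(** The case of an exponent at least 1, applied to [c i `^ k] and the exponent 1 / k. *)
Lemma le_sum_powR_small (c : I -> R) (k : R) : (forall i, 0 <= c i) -> 0 < k <= 1 ->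
  (\sum_(i in S) c i) `^ k <= \sum_(i in S) c i `^ k.
Proof.
move=> c0 /andP[k0 k1]; have k'1 : 1 <= k^-1 by rewrite invf_ge1.
have P0 : 0 <= \sum_(i in S) c i `^ k by apply: sumr_ge0 => i _; apply: powR_ge0.
have := @sum_powR_le (fun i => c i `^ k) k^-1 (fun i => powR_ge0 _ _) k'1.
under eq_bigr do rewrite -powRrM divff ?gt_eqF // powRr1 //.
move=> h; apply: le_trans (_ : ((\sum_(i in S) c i `^ k) `^ k^-1) `^ k <= _).
  by rewrite ge0_ler_powR ?nnegrE ?powR_ge0 ?(ltW k0) // sumr_ge0.
by rewrite -powRrM mulVf ?gt_eqF // powRr1.
Qed.

Lemma sum_powR_le_small (c : I -> R) (k : R) : (forall i, 0 <= c i) -> 0 < k <= 1 ->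
  \sum_(i in S) c i `^ k <= N `^ (1 - k) * (\sum_(i in S) c i) `^ k.
Proof.
move=> c0 /andP[k0 k1]; have k'1 : 1 <= k^-1 by rewrite invf_ge1.
have P0 : 0 <= \sum_(i in S) c i `^ k by apply: sumr_ge0 => i _; apply: powR_ge0.
have C0 : 0 <= \sum_(i in S) c i by apply: sumr_ge0.
have := @le_sum_powR (fun i => c i `^ k) k^-1 (fun i => powR_ge0 _ _) k'1.
under [X in _ <= _ * X -> _]eq_bigr do rewrite -powRrM divff ?gt_eqF // powRr1 //.
move=> h; have -> : \sum_(i in S) c i `^ k = ((\sum_(i in S) c i `^ k) `^ k^-1) `^ k.
  by rewrite -powRrM mulVf ?gt_eqF // powRr1.
apply: le_trans (_ : (N `^ (k^-1 - 1) * \sum_(i in S) c i) `^ k <= _).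
  by rewrite ge0_ler_powR ?nnegrE ?mulr_ge0 ?powR_ge0 ?(ltW k0).
rewrite powRM ?powR_ge0 // -powRrM mulrBl mulVf ?gt_eqF // mul1r.
exact: lexx.
Qed.

End PowerMeans.

Section Absorption.
Context {R : realType} {I : finType} (S : {set I}).
Variables (p q lambda l0 : R) (u : I -> R).
Hypotheses (p_gt1 : 1 < p) (q_gt0 : 0 < q) (q_lt : q < p - 1).
Hypotheses (lambda_gt0 : 0 < lambda) (l0_gt0 : 0 < l0).
Let N : R := #|S|%:R.
Let M := \sum_(x in S) u x ^+ 2.
Hypothesis M_gt0 : 0 < M.
Let P := \sum_(x in S) `|u x| `^ p.
Let Q := \sum_(x in S) `|u x| `^ (q + 1).

(** The hypotheses bound P from below and Q from above by powers of M up to powers of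
N.  The ratio of the two bounds is the power (p - q - 1) / 2 of M, which the last
hypothesis makes large enough. *)
Lemma absorb_of_exponents (a b c : R) : 0 < N -> c = a + b ->
  M `^ (p / 2) <= N `^ a * P -> Q <= N `^ b * M `^ ((q + 1) / 2) ->
  (lambda * N `^ c / l0) `^ (2 / (p - q - 1)) <= M -> lambda * Q <= l0 * P.
Proof.
move=> N0 -> hP hQ hM.
have th : 0 < p - q - 1 by move: q_lt; lra.
pose X := lambda * N `^ (a + b) / l0.
have X0 : 0 <= X by rewrite divr_ge0 ?mulr_ge0 ?powR_ge0 // ltW.
have XM : X <= M `^ ((p - q - 1) / 2).
  have -> : X = (X `^ (2 / (p - q - 1))) `^ ((p - q - 1) / 2).
    rewrite -powRrM (_ : _ * _ = 1) ?powRr1 //.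
    by field; rewrite gt_eqF.
  by rewrite ge0_ler_powR ?nnegrE ?powR_ge0 ?(ltW M_gt0) // divr_ge0 // ltW.
have MX : X * M `^ ((q + 1) / 2) <= M `^ (p / 2).
  have -> : p / 2 = (p - q - 1) / 2 + (q + 1) / 2 by field.
  rewrite (powRD (s := (q + 1) / 2)); last by rewrite (gt_eqF M_gt0) implybT.
  by rewrite ler_wpM2r // powR_ge0.
have Na : 0 < N `^ a by rewrite powR_gt0.
apply: le_trans (_ : lambda * (N `^ b * M `^ ((q + 1) / 2)) <= _).
  by rewrite ler_pM2l.
rewrite -(ler_pM2l Na).
have -> : N `^ a * (lambda * (N `^ b * M `^ ((q + 1) / 2)))
    = l0 * (X * M `^ ((q + 1) / 2)).
  rewrite /X powRD; last by rewrite (gt_eqF N0) implybT.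
  by field; rewrite gt_eqF.
rewrite [leRHS]mulrCA ler_pM2l //; exact: le_trans MX hP.
Qed.

Lemma norm_powR_sqr (s : R) x : `|u x| `^ s = (u x ^+ 2) `^ (s / 2).
Proof.
rewrite -real_normK ?num_real // -powR_mulrn // -powRrM; congr powR.
by field.
Qed.

(** The three constants correspond to the cases p >= 2 with q >= 1, p >= 2 with q < 1,
and p < 2 (where q < 1): the power sums compare with powers of M in opposite
ways according to whether the exponents p / 2 and (q + 1) / 2 exceed 1 or not. *)
Lemma reaction_absorbed :
  Num.max ((lambda * N `^ ((p - 2) / 2) / l0) `^ (2 / (p - q - 1)))
    (Num.max ((lambda * N `^ ((p - q - 1) / 2) / l0) `^ (2 / (p - q - 1)))
      ((lambda * N `^ ((1 - q) / 2) / l0) `^ (2 / (p - q - 1)))) <= M ->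
  lambda * Q <= l0 * P.
Proof.
have p_large : 2 <= p -> 1 <= p / 2 by move=> ?; lra.
have p_small : p < 2 -> 0 < p / 2 <= 1 by move: p_gt1 => ? ?; lra.
have q_large : 1 <= q -> 1 <= (q + 1) / 2 by move=> ?; lra.
have q_small : q < 1 -> 0 < (q + 1) / 2 <= 1 by move: q_gt0 => ? ?; lra.
have pq_small : p < 2 -> q < 1 by move: q_lt => ? ?; lra.
rewrite !ge_max => /and3P[h1 h2 h3].
have N0 : 0 < N.
  rewrite ltr0n card_gt0; apply/negP => /eqP S0.
  by move: M_gt0; rewrite /M S0 big_set0 ltxx.
have sq0 i : 0 <= u i ^+ 2 by exact: sqr_ge0.
have PE : P = \sum_(x in S) (u x ^+ 2) `^ (p / 2).
  by apply: eq_bigr => x _; exact: norm_powR_sqr.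
have QE : Q = \sum_(x in S) (u x ^+ 2) `^ ((q + 1) / 2).
  by apply: eq_bigr => x _; exact: norm_powR_sqr.
have [p2|p2] := leP 2 p.
  have hP : M `^ (p / 2) <= N `^ ((p - 2) / 2) * P.
    rewrite PE (_ : (p - 2) / 2 = p / 2 - 1); last by field.
    by apply: le_sum_powR; [exact: sq0|exact: p_large].
  have [q1|q1] := leP 1 q.
    apply: (@absorb_of_exponents _ 0 _ N0 _ hP _ h1); first by rewrite addr0.
    by rewrite powRr0 mul1r QE; apply: sum_powR_le; [exact: sq0|exact: q_large].
  apply: (@absorb_of_exponents _ ((1 - q) / 2) _ N0 _ hP _ h2).
    by field.
  rewrite QE (_ : (1 - q) / 2 = 1 - (q + 1) / 2); last by field.
  by apply: sum_powR_le_small; [exact: sq0|exact: q_small].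
apply: (@absorb_of_exponents 0 ((1 - q) / 2) _ N0 _ _ _ h3); first by rewrite add0r.
  by rewrite powRr0 mul1r PE; apply: le_sum_powR_small; [exact: sq0|exact: p_small].
rewrite QE (_ : (1 - q) / 2 = 1 - (q + 1) / 2); last by field.
by apply: sum_powR_le_small; [exact: sq0|exact/q_small/pq_small].
Qed.

End Absorption.

(** * A priori bound *)

(** After the last time at which [f <= K], [f] would be nonincreasing. *)
Lemma barrier (R : realType) (f : R -> R) (K b : R) : 0 < b ->
  {within `[0, b], continuous f} ->
  (forall t, t \in `]0, b[%R -> derivable f t 1) ->
  (forall t, t \in `]0, b[%R -> K < f t -> derive1 f t <= 0) ->
  f 0 <= K -> f b <= K.
Proof.
move=> b0 cf df df_le0 f0; rewrite leNgt; apply/negP => fb.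
pose A := [set s : R | 0 <= s <= b /\ f s <= K].
have A0 : A 0 by split => //; rewrite lexx ltW.
have hA : has_sup A.
  by split; [exists 0|exists b => s [/andP[]]].
pose s := sup A.
have s0 : 0 <= s by apply: ub_le_sup => //; case: hA.
have sb : s <= b by apply: ge_sup; [exists 0|move=> r [/andP[]]].
have fsK : f s <= K.
  rewrite leNgt; apply/negP => fs.
  have /subspace_continuousP/(_ s) : {within `[0, b], continuous f} by [].
  rewrite /= in_itv /= s0 sb => /(_ isT) /cvgrPdist_lt /(_ (f s - K)).
  rewrite subr_gt0 => /(_ fs) /nbhs_ballP[e e0 eP].
  have [a [/andP[a0 ab] faK] sa] := sup_adherent e0 hA.
  have as' : a <= s by apply: ub_le_sup; [case: hA|split => //; apply/andP].
  have /= := eP a; rewrite /ball /= ger0_norm ?subr_ge0 // ltrBlDl -ltrBlDr.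
  move=> /(_ sa); rewrite in_itv /= a0 ab => /(_ isT).
  by rewrite ltr_norml => /andP[_]; rewrite ltrD2l ltrN2 ltNge faK.
have sltb : s < b by rewrite lt_neqAle sb andbT; apply: contraTneq fb => <-; rewrite -leNgt.
have sub t : t \in `]s, b[%R -> t \in `]0, b[%R.
  by rewrite !in_itv /= => /andP[st ->]; rewrite (le_lt_trans s0 st).
have gtK t : t \in `]s, b[%R -> K < f t.
  rewrite in_itv /= => /andP[st tb]; rewrite ltNge; apply/negP => ft.
  have : t <= s by apply: ub_le_sup; [case: hA|split => //; rewrite (le_trans s0 (ltW st)) ltW].
  by rewrite leNgt st.
have : f b <= f s.
  apply: (@ler0_derive1_nincr _ f s b) => //.
  - by move=> t /sub /df.
  - by move=> t tsb; apply: df_le0; [exact: sub|exact: gtK].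
  - apply: continuous_subspaceW cf => t /=; rewrite !in_itv /= => /andP[st ->].
    by rewrite (le_trans s0 st).
by move=> fbs; move: (le_lt_trans (le_trans fbs fsK) fb); rewrite ltxx.
Qed.

Lemma is_derive_sumr (R : realType) (I : Type) (s : seq I) (P : pred I)
    (f : I -> R -> R) (df : I -> R) (t : R) :
  (forall i, P i -> is_derive t 1 (f i) (df i)) ->
  is_derive t 1 (fun x => \sum_(i <- s | P i) f i x) (\sum_(i <- s | P i) df i).
Proof.
move=> fP; elim: s => [|i s IH].
  rewrite big_nil (_ : (fun x => _) = cst 0); first exact: is_derive_cst.
  by apply/funext => x; rewrite big_nil.
rewrite big_cons (_ : (fun x => _) =
    fun x => if P i then f i x + \sum_(j <- s | P j) f j x else \sum_(j <- s | P j) f j x).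
  by case: ifP => // /fP ?; exact: is_deriveD.
by apply/funext => x; rewrite big_cons.
Qed.

Section APriori.
Context {R : realType} {V : finType} (G : network R V) (S : {set V}).
Hypothesis S_connected : connected_in (adj G) S.
Variables (p q lambda : R) (mu sigma u0 : V -> R) (T : \bar R) (u : V -> R -> R).
Hypotheses (p_gt1 : 1 < p) (lambda_gt0 : 0 < lambda).
Hypotheses (q_gt0 : 0 < q) (q_lt : q < p - 1).
Hypothesis mu_ge0 : forall z, z \in boundary G S -> 0 <= mu z.
Hypothesis sigma_ge0 : forall z, z \in boundary G S -> 0 <= sigma z.
Hypothesis mu_sigma_gt0 : forall z, z \in boundary G S -> 0 < mu z + sigma z.
Hypothesis sigma_neq0 : exists2 z, z \in boundary G S & sigma z != 0.
Hypothesis u_sol : solution G S p q lambda mu sigma u0 T u.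

Let l0 := first_eigenvalue G S p mu sigma.
Let N : R := #|S|%:R.

Definition mass_bound : R :=
  Num.max (\sum_(x in S) u0 x ^+ 2)
    (Num.max ((lambda * N `^ ((p - 2) / 2) / l0) `^ (2 / (p - q - 1)))
      (Num.max ((lambda * N `^ ((p - q - 1) / 2) / l0) `^ (2 / (p - q - 1)))
        ((lambda * N `^ ((1 - q) / 2) / l0) `^ (2 / (p - q - 1))))).

Let mass (t : R) : R := \sum_(x in S) u x t ^+ 2.

Lemma boundary_condition_at t : 0 <= t -> (t%:E < T)%E ->
  {in boundary G S, forall z, boundary_condition G S p mu sigma (u ^~ t) z}.
Proof. by move=> t0 tT z zB; exact: (sol_boundary u_sol). Qed.

Lemma is_derive_mass t : 0 < t -> (t%:E < T)%E ->
  is_derive t 1 mass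
    (2 * (lambda * \sum_(x in S) `|u x t| `^ (q + 1) - energy G S p mu sigma (u ^~ t))).
Proof.
move=> t0 tT.
have d x : x \in S -> is_derive t 1 (fun s => u x s ^+ 2)
    (2 * (u x t * plaplacian G S p (u ^~ t) x + lambda * `|u x t| `^ (q + 1))).
  move=> xS.
  have ux : is_derive t 1 (u x) (derive1 (u x) t).
    rewrite derive1E; apply/derivableP.
    by apply: (sol_derivable u_sol) => //; exact: sub_closed_dom.
  have h := is_deriveM ux ux; apply: is_derive_eq.
  rewrite (sol_equation u_sol xS t0 tT) /GRing.scale /=.
  have q1 : -1 < q - 1 by rewrite ltrBrDl subrr.
  have <- : u x t * spow (q - 1) (u x t) = `|u x t| `^ (q + 1).
    by rewrite mulr_spow // -addrA; congr (_ `^ (_ + _)); ring.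
  by ring.
have h := is_derive_sumr (index_enum V) d; apply: is_derive_eq h _.
rewrite -mulr_sumr big_split /= -mulr_sumr (green_identity p_gt1 mu_ge0 mu_sigma_gt0).
  by rewrite addrC.
by apply: boundary_condition_at => //; exact: ltW.
Qed.

Lemma continuous_mass b : 0 <= b -> (b%:E < T)%E ->
  {within `[0, b], continuous mass}.
Proof.
move=> b0 bT; apply/subspace_continuousP => t tb.
apply: cvg_sumr => x xS.
have c : u x @ within `[0, b] (nbhs t) --> u x t.
  have cx := sol_continuous u_sol (sub_closed_dom G xS).
  have /subspace_continuousP : {within `[0, b], continuous (u x)}.
    apply: continuous_subspaceW cx => s /=; rewrite in_itv /= => /andP[s0 sb].
    by split => //; apply: le_lt_trans bT; rewrite lee_fin.
  exact.
exact: cvgM.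
Qed.

Lemma mass0_le_bound : mass 0 <= mass_bound.
Proof.
rewrite (_ : mass 0 = \sum_(x in S) u0 x ^+ 2); first by rewrite le_max lexx.
by apply: eq_bigr => x xS; rewrite (sol_initial u_sol (sub_closed_dom G xS)).
Qed.

Lemma mass_le_bound t : 0 <= t -> (t%:E < T)%E -> mass t <= mass_bound.
Proof.
rewrite le_eqVlt => /predU1P[<- _|t0 tT]; first exact: mass0_le_bound.
have sT s : s \in `]0, t[%R -> 0 < s /\ (s%:E < T)%E.
  by rewrite in_itv /= => /andP[? st]; split => //; apply: lt_trans tT; rewrite lte_fin.
apply: (barrier t0); first by apply: continuous_mass => //; exact: ltW.
- by move=> s /sT[s0 /(is_derive_mass s0)[]].
- move=> s /sT[s0 sT'] Ms.
  rewrite derive1E (@derive_val _ _ _ _ _ _ _ (is_derive_mass s0 sT')).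
  rewrite pmulr_rle0 // subr_le0.
  have van : vanishing_off_Gamma G S mu (u ^~ s).
    move=> z zB; apply: (boundary_condition_out (p := p) (u := u ^~ s) mu_ge0 mu_sigma_gt0 zB).
    by apply: boundary_condition_at => //; exact: ltW.
  apply: le_trans _ (first_eigenvalue_le p_gt1 mu_ge0 sigma_ge0 van).
  apply: (@reaction_absorbed R V S p q lambda l0 (u ^~ s)) => //.
  + exact: first_eigenvalue_gt0.
  + apply: le_lt_trans Ms; rewrite le_max sumr_ge0 // => x _; exact: sqr_ge0.
  + by apply: le_trans (ltW Ms); rewrite le_max lexx orbT.
- exact: mass0_le_bound.
Qed.

End APriori.

(** * The autonomous system on the inner vertices *)

Section SupNeighbourhoods.
Context {R : realType} {V : finType}.

Definition sup_nbhs (a : V -> R) : set_system (V -> R) :=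
  filter_from [set d : R | 0 < d] (fun d => [set b | forall y, `|b y - a y| <= d]).

Global Instance sup_nbhs_filter a : Filter (sup_nbhs a).
Proof.
apply: filter_from_filter; first by exists 1 => /=.
move=> d1 d2 /= d1_gt0 d2_gt0; exists (Num.min d1 d2) => /=.
  by rewrite lt_min d1_gt0.
by move=> b hb; split=> y; have := hb y; rewrite le_min => /andP[].
Qed.

(** On finitely many coordinates, coordinatewise convergence is uniform. *)
Lemma continuous_fieldP (f : (V -> R) -> V -> R) :
  (forall a x, f b x @[b --> sup_nbhs a] --> f a x) -> continuous_field f.
Proof.
move=> fc a e e0.
have /filter_forall[d d0 dP] : forall x, \forall b \near sup_nbhs a, `|f b x - f a x| <= e.
  by move=> x; have /cvgrPdist_le/(_ e e0) := fc a x; apply: filterS => b; rewrite distrC.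
by exists d.
Qed.

End SupNeighbourhoods.

Section Clip.
Context {R : realType}.
Implicit Types B s t : R.

(** Truncation makes the right-hand side bounded while leaving it unchanged on a
box. *)
Definition clip B s : R := Num.max (- B) (Num.min B s).

Lemma clip_id B s : `|s| <= B -> clip B s = s.
Proof. by rewrite ler_norml => /andP[? ?]; rewrite /clip min_r // max_r. Qed.

Lemma norm_clip B s : 0 <= B -> `|clip B s| <= B.
Proof.
move=> B0; rewrite ler_norml /clip le_max lexx /= ge_max ge_min lexx andbT.
by rewrite (le_trans _ B0) // oppr_le0.
Qed.

Lemma clip_dist B s t : 0 <= B -> `|clip B s - clip B t| <= `|s - t|.
Proof.
move=> B0; have mono x y : x <= y -> 0 <= clip B y - clip B x <= y - x.
  have NB : - B <= B by lra.
  rewrite /clip !maxEle !minEle => xy.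
  case: (leP B x) => ?; case: (leP B y) => ?; rewrite ?NB.
  - by lra.
  - by lra.
  - by case: (leP (- B) x) => ?; lra.
  - by case: (leP (- B) x) => ?; case: (leP (- B) y) => ?; lra.
case/orP: (le_total s t) => /mono/andP[lo hi].
  by rewrite distrC (distrC s) !ger0_norm //; lra.
by rewrite !ger0_norm //; lra.
Qed.

End Clip.

Section Field.
Context {R : realType} {V : finType} (G : network R V) (S : {set V}).
Variables (p q lambda : R) (mu sigma : V -> R).
Hypotheses (p_gt1 : 1 < p) (lambda_gt0 : 0 < lambda) (q_gt0 : 0 < q).
Hypothesis mu_ge0 : forall z, z \in boundary G S -> 0 <= mu z.
Hypothesis sigma_ge0 : forall z, z \in boundary G S -> 0 <= sigma z.
Hypothesis mu_sigma_gt0 : forall z, z \in boundary G S -> 0 < mu z + sigma z.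

Let D := closed_dom G S.
Let ext := extension G S p mu sigma.

(** The right-hand side of the system for the inner values, once the boundary values
are expressed through them. *)
Definition rd_field (a : V -> R) (x : V) : R :=
  if x \in S then plaplacian G S p (ext a) x + lambda * spow (q - 1) (a x) else 0.

Lemma cvg_extension (T : Type) (F : set_system T) {FF : Filter F}
    (a : T -> V -> R) (a0 : V -> R) x : x \in D ->
  (forall y, y \in S -> a t y @[t --> F] --> a0 y) ->
  ext (a t) x @[t --> F] --> ext a0 x.
Proof.
move=> xD ac; apply/cvgrPdist_le => e e0.
have : \forall t \near F, forall y, y \in S -> `|a0 y - a t y| <= e.
  apply: filter_forall => y; have [yS|_] := boolP (y \in S); last exact: nearW.
  by have /cvgrPdist_le/(_ e e0) := ac y yS; apply: filterS.
apply: filterS => t h.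
exact: (extension_dist p_gt1 mu_ge0 sigma_ge0 mu_sigma_gt0 xD (ltW e0) h).
Qed.

Lemma cvg_field (T : Type) (F : set_system T) {FF : Filter F}
    (a : T -> V -> R) (a0 : V -> R) x :
  (forall y, y \in S -> a t y @[t --> F] --> a0 y) ->
  rd_field (a t) x @[t --> F] --> rd_field a0 x.
Proof.
move=> ac; rewrite /rd_field; have [xS|_] := boolP (x \in S); last exact: cvg_cst.
have cs r (b : T -> R) (l : R) : -1 < r -> b t @[t --> F] --> l ->
    spow r (b t) @[t --> F] --> spow r l.
  by move=> r1 bl; exact: (continuous_cvg _ (continuous_spow r1 (x := l)) bl).
apply: cvgD; last first.
  by apply: cvgMr; apply: cs; [rewrite ltrBrDl subrr|exact: ac].
under eq_cvg do rewrite plaplacianE; rewrite plaplacianE.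
apply: cvg_sumr => y yD; apply: cvgMl.
apply: cs; first exact: gt1_sub2.
by apply: cvgB; apply: cvg_extension => //; exact: sub_closed_dom.
Qed.

Lemma continuous_field_clip B : 0 <= B ->
  continuous_field (fun a => rd_field (fun y => clip B (a y))).
Proof.
move=> B0; apply: continuous_fieldP => a x; apply: cvg_field => y _.
apply/cvgrPdist_le => e e0; exists e => // b hb /=.
by apply: le_trans (clip_dist _ _ B0) _; rewrite distrC.
Qed.

Lemma field_bounded B : 0 <= B -> exists M : R, forall a x,
  (forall y, y \in S -> `|a y| <= B) -> `|rd_field a x| <= M.
Proof.
move=> B0; pose W := \sum_(x : V) \sum_(y : V) dom_weight G S x y.
have W0 : 0 <= W.
  by apply: sumr_ge0 => x _; apply: sumr_ge0 => y _; exact: dom_weight_ge0.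
exists ((B + B) `^ (p - 2 + 1) * W + lambda * B `^ (q - 1 + 1)) => a x aB.
have M0 : 0 <= (B + B) `^ (p - 2 + 1) * W + lambda * B `^ (q - 1 + 1).
  by rewrite addr_ge0 // mulr_ge0 ?powR_ge0 // ltW.
rewrite /rd_field; have [xS|_] := boolP (x \in S); last by rewrite normr0.
have q1 : -1 < q - 1 by rewrite ltrBrDl subrr.
have p2 := gt1_sub2 p_gt1.
have p2' : 0 <= p - 2 + 1 by rewrite -lerBlDr sub0r ltW.
have q1' : 0 <= q - 1 + 1 by rewrite -lerBlDr sub0r ltW.
apply: le_trans (ler_normD _ _) (lerD _ _); last first.
  rewrite normrM (gtr0_norm lambda_gt0) ler_pM2l // norm_spow //.
  by rewrite ge0_ler_powR ?nnegrE // aB.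
have extB y : y \in D -> `|ext a y| <= B.
  by move=> yD; apply: extension_norm.
have xD := sub_closed_dom G xS.
rewrite plaplacianE; apply: le_trans (ler_norm_sum _ _ _) _.
apply: (@le_trans _ _ (\sum_(y in D) (B + B) `^ (p - 2 + 1) * dom_weight G S x y)).
  apply: ler_sum => y yD; rewrite normrM (ger0_norm (dom_weight_ge0 _ _ _ _)).
  apply: ler_wpM2r; first exact: dom_weight_ge0.
  rewrite norm_spow //; apply: ge0_ler_powR => //; rewrite ?nnegrE ?addr_ge0 //.
  by apply: le_trans (ler_normB _ _) (lerD _ _); exact: extB.
rewrite -mulr_sumr ler_wpM2l ?powR_ge0 // /W [leRHS](bigD1 x) //=.
apply: ler_wpDr.
  by apply: sumr_ge0 => y _; apply: sumr_ge0 => z _; exact: dom_weight_ge0.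
rewrite [leRHS](bigID (mem D)) /= lerDl; apply: sumr_ge0 => y _.
exact: dom_weight_ge0.
Qed.

Lemma eq_field a b : {in S, a =1 b} -> rd_field a =1 rd_field b.
Proof.
move=> ab x; rewrite /rd_field /ext (eq_extension G p mu sigma ab).
by case: ifPn => // /ab ->.
Qed.

End Field.

(** Adding [M * s] makes [g] nondecreasing and bounded, so that the limit is a
supremum; the Lipschitz bound is kept up to the end point. *)
Lemma lipschitz_left_limit (R : realType) (g : R -> R) (T M : R) : 0 < T -> 0 <= M ->
  (forall s t, 0 <= s -> s <= t -> t < T -> `|g t - g s| <= M * (t - s)) ->
  exists l, forall s, 0 <= s -> s < T -> `|l - g s| <= M * (T - s).
Proof.
move=> T0 M0 lip; pose A := [set g s + M * s | s in [set s : R | 0 <= s < T]].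
have bnd s t : 0 <= s < T -> 0 <= t < T -> g t + M * t <= g s + M * s + 2 * (M * (T - s)).
  move=> /andP[s0 sT] /andP[t0 tT].
  have MTt : M * t <= M * T by rewrite ler_wpM2l // ltW.
  case/orP: (le_total s t) => st.
    by have := lip s t s0 st tT; rewrite ler_norml !mulrBr; lra.
  have MsT : M * s <= M * T by rewrite ler_wpM2l // ltW.
  by have := lip t s t0 st sT; rewrite ler_norml !mulrBr; lra.
have hA : has_sup A.
  split; first by exists (g 0 + M * 0), 0 => //=; rewrite lexx.
  exists (g 0 + M * 0 + 2 * (M * (T - 0))) => _ [t tT <-].
  by apply: bnd => //; rewrite lexx.
exists (sup A - M * T) => s s0 sT.
have sI : 0 <= s < T by rewrite s0.
have lo : g s + M * s <= sup A by apply: ub_le_sup; [case: hA|exists s].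
have hi : sup A <= g s + M * s + 2 * (M * (T - s)).
  by apply: ge_sup; [case: hA|move=> _ [t tT <-]; exact: bnd].
by rewrite ler_norml !mulrBr in lo hi *; lra.
Qed.

Lemma is_derive_of_slope (R : realType) (f : R -> R) (t l : R) :
  (forall e, 0 < e -> exists2 d, 0 < d & forall s, `|s - t| < d ->
    `|f s - f t - (s - t) * l| <= e * `|s - t|) ->
  is_derive t 1 f l.
Proof.
move=> H.
have c : h^-1 *: (f (h *: 1 + t) - f t) @[h --> 0^'] --> l.
  apply/cvgrPdist_le => e e0; have [d d0 dP] := H e e0.
  apply/nbhs_ballP; exists d => // h; rewrite /ball /= sub0r normrN => hd h0.
  have := dP (h + t); rewrite addrK => /(_ hd).
  rewrite /GRing.scale /= mulr1 => h1.
  have -> : l - h^-1 * (f (h + t) - f t) = - (h^-1 * (f (h + t) - f t - h * l)) by field.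
  rewrite normrN normrM normfV ler_pdivrMl ?normr_gt0 //.
  by rewrite [leRHS]mulrC.
by apply: DeriveDef; [apply/cvg_ex; exists l|exact: cvg_lim].
Qed.

(** * Prolongation of the inner values beyond a finite time *)

Section Continuation.
Context {R : realType} {V : finType} (G : network R V) (S : {set V}).
Hypothesis S_connected : connected_in (adj G) S.
Variables (p q lambda : R) (mu sigma u0 : V -> R) (T : R) (u : V -> R -> R).
Hypotheses (p_gt1 : 1 < p) (lambda_gt0 : 0 < lambda).
Hypotheses (q_gt0 : 0 < q) (q_lt : q < p - 1).
Hypothesis mu_ge0 : forall z, z \in boundary G S -> 0 <= mu z.
Hypothesis sigma_ge0 : forall z, z \in boundary G S -> 0 <= sigma z.
Hypothesis mu_sigma_gt0 : forall z, z \in boundary G S -> 0 < mu z + sigma z.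
Hypothesis sigma_neq0 : exists2 z, z \in boundary G S & sigma z != 0.
Hypothesis u_sol : solution G S p q lambda mu sigma u0 T%:E u.

Let D := closed_dom G S.
Let ext := extension G S p mu sigma.
Let fld := rd_field G S p q lambda mu sigma.

Let T_gt0 : 0 < T.
Proof. by have := sol_time u_sol; rewrite lte_fin. Qed.

Lemma eq_plaplacian (a b : V -> R) x : x \in D -> {in D, a =1 b} ->
  plaplacian G S p a x = plaplacian G S p b x.
Proof.
by move=> xD ab; apply: eq_bigr => y yD; rewrite !ab.
Qed.

Lemma solution_extension t : 0 <= t -> t < T -> {in D, u ^~ t =1 ext (u ^~ t)}.
Proof.
move=> t0 tT x xD.
apply: (@extension_unique R V G S p mu sigma p_gt1 mu_ge0 sigma_ge0 mu_sigma_gt0) => //.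
by move=> z zB; apply: (sol_boundary u_sol); rewrite ?lte_fin.
Qed.

Lemma solution_is_derive x t : x \in S -> 0 < t -> t < T ->
  is_derive t 1 (u x) (fld (u ^~ t) x).
Proof.
move=> xS t0 tT; have xD := sub_closed_dom G xS.
have d : derivable (u x) t 1 by apply: (sol_derivable u_sol); rewrite ?lte_fin.
apply: DeriveDef => //; rewrite -derive1E (sol_equation u_sol) ?lte_fin //.
rewrite /fld /rd_field xS; congr (_ + _).
by apply: eq_plaplacian => //; apply: solution_extension => //; exact: ltW.
Qed.

Lemma solution_bounded : exists2 B : R, 0 <= B &
  forall x t, x \in S -> 0 <= t -> t < T -> `|u x t| <= B.
Proof.
exists (Num.sqrt (mass_bound G S p q lambda mu sigma u0)); first exact: sqrtr_ge0.
move=> x t xS t0 tT; rewrite -sqrtr_sqr ler_wsqrtr //.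
apply: le_trans (_ : \sum_(y in S) u y t ^+ 2 <= _).
  by rewrite (bigD1 x) //= lerDl sumr_ge0 // => y _; exact: sqr_ge0.
by apply: (mass_le_bound S_connected p_gt1 lambda_gt0 q_gt0 q_lt mu_ge0 sigma_ge0
  mu_sigma_gt0 sigma_neq0 u_sol t0); rewrite lte_fin.
Qed.

Lemma solution_continuous_within x a b : x \in D -> 0 <= a -> b < T ->
  {within `[a, b], continuous (u x)}.
Proof.
move=> xD a0 bT; apply: continuous_subspaceW (sol_continuous u_sol xD) => s /=.
rewrite in_itv /= => /andP[sa sb]; rewrite lte_fin.
by split; [exact: le_trans a0 sa|exact: le_lt_trans sb bT].
Qed.

(** The mass bound confines the solution to a box, where the right-hand side of the
system is bounded; the solution is thus Lipschitz in time. *)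
Lemma solution_left_limit : exists L : V -> R, exists2 M : R, 0 <= M &
  forall x s, x \in S -> 0 <= s -> s < T -> `|L x - u x s| <= M * (T - s).
Proof.
have [B B0 uB] := solution_bounded.
have [M' M'P] := field_bounded p_gt1 lambda_gt0 q_gt0 mu_ge0 sigma_ge0 mu_sigma_gt0 B0.
pose M := Num.max 0 M'; have M0 : 0 <= M by rewrite le_max lexx.
have lip x : x \in S -> forall s t, 0 <= s -> s <= t -> t < T ->
    `|u x t - u x s| <= M * (t - s).
  move=> xS s t s0 st tT.
  have [||c cst ->] := @MVT_segment _ (u x) (fun c => fld (u ^~ c) x) s t st.
  - move=> c; rewrite in_itv /= => /andP[sc ct].
    by apply: solution_is_derive => //; [exact: le_lt_trans s0 sc|exact: lt_trans tT].
  - by apply: solution_continuous_within => //; exact: sub_closed_dom.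
  move: cst; rewrite in_itv /= => /andP[sc ct].
  rewrite normrM (ger0_norm (_ : 0 <= t - s)) ?subr_ge0 // ler_wpM2r ?subr_ge0 //.
  rewrite le_max M'P ?orbT // => y yS.
  by apply: uB => //; [exact: le_trans sc|exact: le_lt_trans tT].
have /choice[L LP] : forall x, exists l : R, x \in S ->
    forall s, 0 <= s -> s < T -> `|l - u x s| <= M * (T - s).
  move=> x; have [xS|_] := boolP (x \in S); last by exists 0.
  by have [l lP] := lipschitz_left_limit T_gt0 M0 (lip x xS); exists l.
by exists L, M => // x s xS; exact: LP.
Qed.

(** Up to [T] the curve is the solution, from [T] on it is a solution of the truncated
system started at the left limit, for a time so short that the truncation is not
felt.  At [T] the left derivative is obtained from the mean value theorem and the
continuity of the right-hand side, the right one from the Peano theorem. *)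
Lemma glued_trajectory : exists d : R, exists2 a : R -> V -> R, 0 < d &
  (forall t x, x \in S -> 0 <= t -> t < T -> a t x = u x t) /\
  (forall t x, x \in S -> 0 < t -> t < T + d ->
     is_derive t 1 (a ^~ x) (fld (a t) x)).
Proof.
have [L0 [M M0 LM]] := solution_left_limit.
have [B B0 uB] := solution_bounded.
pose L := inner_part S L0.
have LS x : x \in S -> L x = L0 x by rewrite /L /inner_part => ->.
(* The limit L lies in the box of size B + M * T; the margin 1 of B1 leaves room to
move for a time d before the truncation acts. *)
pose B1 := B + M * T + 1.
have MT0 : 0 <= M * T by rewrite mulr_ge0 // ltW.
have B1_ge0 : 0 <= B1 by rewrite addr_ge0 // addr_ge0.
have LB x : `|L x| <= B + M * T.
  have [xS|xS] := boolP (x \in S); last first.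
    by rewrite /L /inner_part (negbTE xS) normr0 addr_ge0.
  rewrite LS // -(subrK (u x 0) (L0 x)) addrC.
  apply: le_trans (ler_normD _ _) (lerD _ _); first exact: uB.
  by have := LM x 0 xS (lexx 0) T_gt0; rewrite subr0.
have [M1 M1P] := field_bounded p_gt1 lambda_gt0 q_gt0 mu_ge0 sigma_ge0 mu_sigma_gt0 B1_ge0.
pose f a := fld (fun y => clip B1 (a y)).
have [||U [U0 U_lip U_slope]] := @peano_existence R V f (Num.max 0 M1) L.
- move=> a x; rewrite le_max M1P ?orbT // => y _; exact: norm_clip.
- exact: continuous_field_clip.
set M2 := Num.max 0 M1 in U_lip; have M2_ge0 : 0 <= M2 by rewrite le_max lexx.
pose d := (M2 + 1)^-1; have d0 : 0 < d by rewrite invr_gt0 ltr_wpDl.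
have Uf t : 0 <= t -> t < d -> f (U t) = fld (U t).
  move=> t0 td; rewrite /f; congr fld; apply/funext => y; apply: clip_id.
  rewrite -(subrK (L y) (U t y)) addrC; apply: le_trans (ler_normD _ _) (lerD (LB y) _).
  apply: le_trans (U_lip t y t0) _.
  have M21 : 0 < M2 + 1 by rewrite ltr_wpDl.
  have : t * (M2 + 1) <= 1 by rewrite -ler_pdivlMr // div1r ltW.
  by apply: le_trans; rewrite mulrC ler_wpM2l // lerDl.
pose a t x := if t < T then u x t else U (t - T) x.
have a_left t x : t < T -> a t x = u x t by rewrite /a => ->.
have a_right t x : T <= t -> a t x = U (t - T) x by rewrite /a leNgt => /negbTE ->.
have aT x : a T x = L x by rewrite a_right // subrr U0.
exists d, a => //; split=> [t x _ _ tT|]; first exact: a_left.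
have der_left t x : x \in S -> 0 < t -> t < T ->
    is_derive t 1 (a ^~ x) (fld (a t) x).
  move=> xS t0 tT.
  have -> : fld (a t) x = fld (u ^~ t) x by congr fld; apply/funext => y; exact: a_left.
  apply: (near_eq_is_derive _ (solution_is_derive xS t0 tT)).
  by near=> s; rewrite a_left //; near: s; exact: lt_nbhsl.
have a_cont_T x : x \in S -> {for T, continuous (a ^~ x)}.
  move=> xS; apply/cvgrPdist_lt => e e0.
  pose C := M + M2 + 1; have C0 : 0 < C by rewrite ltr_wpDl // addr_ge0.
  near=> s; rewrite aT.
  have sT : `|T - s| < e / C.
    by near: s; apply: (@cvgr_dist_lt _ _ _ (nbhs T) _ id) => //; rewrite divr_gt0.
  have s0 : 0 <= s by apply: ltW; near: s; exact: lt_nbhsr.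
  apply: (@le_lt_trans _ _ (C * `|T - s|)); last by rewrite mulrC -ltr_pdivlMr.
  case: (ltP s T) => sT'.
    rewrite a_left // LS //; apply: le_trans (LM x s xS s0 sT') _.
    have sT_ge0 : 0 <= T - s by rewrite subr_ge0 ltW.
    by rewrite ger0_norm // ler_wpM2r // /C; lra.
  rewrite a_right // distrC; apply: le_trans (U_lip _ _ _) _; first by rewrite subr_ge0.
  by rewrite distrC ger0_norm ?subr_ge0 // ler_wpM2r ?subr_ge0 // /C; lra.
move=> t x xS t0 tTd; case: (ltgtP t T) => [tT|Tt|tT]; first exact: der_left.
- apply: is_derive_of_slope => e e0.
  have tT0 : 0 <= t - T by rewrite subr_ge0 ltW.
  have [d1 d1_gt0 dP] := U_slope (t - T) x e tT0 e0.
  exists (Num.min d1 (t - T)); first by rewrite lt_min d1_gt0 subr_gt0.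
  move=> s; rewrite lt_min => /andP[sd1 sT].
  have Ts : T <= s by move: sT; rewrite ltr_norml => /andP[]; lra.
  rewrite !a_right ?(ltW Tt) //.
  have -> : fld (a t) x = f (U (t - T)) x.
    rewrite Uf ?ltrBlDl //; congr fld; apply/funext => y.
    by rewrite a_right // ltW.
  have E : s - T - (t - T) = s - t by ring.
  by have := dP (s - T); rewrite E subr_ge0; apply.
- rewrite tT in t0 tTd *.
  apply: is_derive_of_slope => e e0.
  have faT : fld (a T) x = fld L x by congr fld; apply/funext => y; exact: aT.
  have [d1 d1_gt0 dP] := U_slope 0 x e (lexx 0) e0.
  have U0L : U 0 = L by apply/funext.
  have f_cont : continuous_field f by exact: continuous_field_clip.
  have [d2 d2_gt0 d2P] := f_cont L e e0.
  have M10 : 0 < M + 1 by rewrite ltr_wpDl.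
  exists (Num.min d1 (Num.min T (d2 / (M + 1)))).
    by rewrite !lt_min d1_gt0 T_gt0 divr_gt0.
  move=> s; rewrite !lt_min => /and3P[sd1 sT sd2].
  rewrite faT aT; case: (leP T s) => Ts.
    rewrite a_right //; have := dP (s - T); rewrite !subr0 subr_ge0 U0L.
    by rewrite -U0L Uf // U0L; apply.
  have s0 : 0 < s by move: sT; rewrite ltr_norml => /andP[]; lra.
  have [||c cs Ec] := @MVT _ (a ^~ x) (fun c => fld (a c) x) s T Ts.
  + move=> c; rewrite in_itv /= => /andP[sc cT].
    by apply: der_left => //; exact: lt_trans sc.
  + apply/subspace_continuousP => c; rewrite /= in_itv /= => /andP[sc cT].
    apply: cvg_within_filter; move: cT; rewrite le_eqVlt => /predU1P[->|cT].
      exact: a_cont_T.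
    have [der _] := der_left c x xS (lt_le_trans s0 sc) cT.
    by apply: differentiable_continuous; apply/derivable1_diffP.
  move: cs; rewrite in_itv /= => /andP[sc cT].
  have -> : a s x - L x - (s - T) * fld L x = (s - T) * (fld (a c) x - fld L x).
    have : L x - a s x = fld (a c) x * (T - s) by rewrite -Ec aT.
    by move=> H; rewrite mulrBr -[a s x - L x]opprB H; ring.
  rewrite normrM mulrC ler_wpM2r //.
  have fL : f L = fld L by rewrite -U0L Uf.
  have fc : fld (a c) x = f (inner_part S (u ^~ c)) x.
    rewrite /f; apply: eq_field => y yS; rewrite a_left // /inner_part yS clip_id //.
    apply: le_trans (uB y c yS _ cT) _; first by rewrite ltW // (lt_trans s0).
    by rewrite /B1 -addrA lerDl addr_ge0.
  rewrite fc -fL; apply: d2P => y; rewrite /L /inner_part; case: ifPn => yS; last first.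
    by rewrite subrr normr0 ltW.
  rewrite distrC; apply: le_trans (LM y c yS _ cT) _; first by rewrite ltW // (lt_trans s0).
  apply: (@le_trans _ _ ((M + 1) * `|s - T|)); last first.
    by rewrite mulrC -ler_pdivlMr // ltW.
  rewrite distrC ger0_norm; last by rewrite subr_ge0 ltW.
  apply: ler_pM => //; first by rewrite subr_ge0 ltW.
    by rewrite lerDl.
  by rewrite lerD2l lerN2 ltW.
Unshelve. all: by end_near. Qed.

End Continuation.

(** * Global existence *)

Section Extend.
Context {R : realType} {V : finType} (G : network R V) (S : {set V}).
Hypothesis S_connected : connected_in (adj G) S.
Variables (p q lambda : R) (mu sigma u0 : V -> R).
Hypotheses (p_gt1 : 1 < p) (lambda_gt0 : 0 < lambda).
Hypotheses (q_gt0 : 0 < q) (q_lt : q < p - 1).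
Hypothesis mu_ge0 : forall z, z \in boundary G S -> 0 <= mu z.
Hypothesis sigma_ge0 : forall z, z \in boundary G S -> 0 <= sigma z.
Hypothesis mu_sigma_gt0 : forall z, z \in boundary G S -> 0 < mu z + sigma z.
Hypothesis sigma_neq0 : exists2 z, z \in boundary G S & sigma z != 0.

Let D := closed_dom G S.
Let ext := extension G S p mu sigma.

(** The boundary values are nonlinear means of the inner ones, whose differentiability
along curves applies with the increment of time as parameter. *)
Lemma derivable_extension (a : R -> V -> R) t x : x \in D ->
  (forall y, y \in S -> derivable (a ^~ y) t 1) ->
  derivable (fun s => ext (a s) x) t 1.
Proof.
move=> xD da; have [xS|xS] := boolP (x \in S).
  rewrite (_ : (fun s => _) = a ^~ x); first exact: da.
  by apply/funext => s; exact: extension_inner.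
have xB : x \in boundary G S by move: xD; rewrite inE (negbTE xS).
have /choice[v vP] : forall y, exists l : R,
    (inner_part S (a (h + t)) y - inner_part S (a t) y) / h @[h --> 0^'] --> l.
  move=> y; rewrite /inner_part; case: ifPn => yS; last first.
    by exists 0; under eq_cvg do rewrite subrr mul0r; exact: cvg_cst.
  have /cvg_ex[l hl] := da y yS; exists l.
  apply: cvg_trans hl; apply: near_eq_cvg; apply: nearW => h /=.
  by rewrite /GRing.scale /= mulr1 mulrC.
have h_cvg0 : h @[h --> (0 : R)^'] --> (0 : R) by exact: cvg_within.
have h_neq0 : \forall h \near (0 : R)^', h != 0 by exact: nbhs_dnbhs_neq.
have [l hl] := pmean_curve_slope (gt1_sub2 p_gt1)
  (trace_weight_ge0 mu_ge0 sigma_ge0 xB)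
  (trace_weight_gt0 mu_ge0 mu_sigma_gt0 xB)
  h_cvg0 h_neq0 vP.
apply/cvg_ex; exists l; apply: cvg_trans hl.
apply: near_eq_cvg; apply: nearW => h /=.
by rewrite /ext /extension (negbTE xS) /GRing.scale /= mulr1 mulrC.
Qed.

Lemma solution_extends (T : R) (u : V -> R -> R) :
  solution G S p q lambda mu sigma u0 T%:E u ->
  exists d : R, exists2 v : V -> R -> R, 0 < d &
    solution G S p q lambda mu sigma u0 (T + d)%:E v /\
    forall x t, x \in D -> 0 <= t -> t < T -> v x t = u x t.
Proof.
move=> u_sol; have T_gt0 : 0 < T by have := sol_time u_sol; rewrite lte_fin.
have [d [a d0 [au da]]] := glued_trajectory S_connected p_gt1 lambda_gt0 q_gt0 q_lt
  mu_ge0 sigma_ge0 mu_sigma_gt0 sigma_neq0 u_sol.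
pose v x t := ext (a t) x.
have vu x t : x \in D -> 0 <= t -> t < T -> v x t = u x t.
  move=> xD t0 tT; rewrite /v (solution_extension p_gt1 mu_ge0 sigma_ge0 mu_sigma_gt0 u_sol t0 tT xD).
  by rewrite /ext (@eq_extension R V G S p mu sigma (a t) (u ^~ t)) // => y yS; exact: au.
exists d, v => //; split => //.
have vD t x : x \in S -> v x t = a t x by exact: extension_inner.
have der y t : y \in S -> 0 < t -> t < T + d -> derivable (a ^~ y) t 1.
  by move=> yS t0 tT; case: (da t y yS t0 tT).
split.
- by rewrite lte_fin addr_gt0.
- move=> x xD; apply/subspace_continuousP => t [t0]; rewrite lte_fin => tT.
  apply: (cvg_extension p_gt1 mu_ge0 sigma_ge0 mu_sigma_gt0 xD) => y yS.
  move: t0; rewrite le_eqVlt => /predU1P[<-|t0].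
    have yD := sub_closed_dom G yS.
    have /subspace_continuousP/(_ 0) := sol_continuous u_sol yD.
    rewrite /= lexx lte_fin => /(_ (conj isT T_gt0)) /cvgrPdist_lt uc.
    apply/cvgrPdist_lt => e e0; have /nbhs_ballP[k k0 kP] := uc e e0.
    apply/nbhs_ballP; exists (Num.min k T) => /=; first by rewrite lt_min k0.
    move=> s; rewrite /ball /= sub0r normrN lt_min => /andP[sk sT] [s0 _].
    have sT' : s < T by rewrite ger0_norm in sT.
    rewrite (au 0) // au //; apply: kP; first by rewrite /ball /= sub0r normrN.
    by split => //; rewrite lte_fin.
  apply: cvg_within_filter; apply: differentiable_continuous.
  by apply/derivable1_diffP; exact: der.
- move=> x t xD t0; rewrite lte_fin => tT.
  by apply: derivable_extension => // y yS; exact: der.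
- move=> x t xS t0; rewrite lte_fin => tT.
  have -> : v x = a ^~ x by apply/funext => s; exact: vD.
  rewrite derive1E (@derive_val _ _ _ _ _ _ _ (da t x xS t0 tT)).
  by rewrite /rd_field xS.
- by move=> z t zB _ _; exact: extension_boundary.
- by move=> x xD; rewrite vu // (sol_initial u_sol).
Qed.

End Extend.

Theorem theorem3p9 (R : realType) (V : finType) (G : network R V)
  (S : {set V}) (S_connected : connected_in (adj G) S)
  (mu sigma : V -> R)
  (mu_ge0 : forall z, z \in boundary G S -> 0 <= mu z)
  (sigma_ge0 : forall z, z \in boundary G S -> 0 <= sigma z)
  (mu_sigma_gt0 : forall z, z \in boundary G S -> 0 < mu z + sigma z)
  (p q lambda : R) (p_gt1 : 1 < p) (lambda_gt0 : 0 < lambda)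
  (q_gt0 : 0 < q) (q_lt : q < p - 1)
  (sigma_neq0 : exists2 z, z \in boundary G S & sigma z != 0)
  (u0 : V -> R) (u0_ge0 : forall x, x \in closed_dom G S -> 0 <= u0 x)
  (T : \bar R) (u : V -> R -> R)
  (u_sol : maximal_solution G S p q lambda mu sigma u0 T u) :
  T = +oo%E /\
  forall t : R, 0 <= t ->
    \sum_(x in S) u x t ^+ 2 <=
    let lambda_p0 := first_eigenvalue G S p mu sigma in
    let card_S : R := #|S|%:R in
    Num.max (\sum_(x in S) u0 x ^+ 2)
      (Num.max
        ((lambda * card_S `^ ((p - 2) / 2) / lambda_p0)
           `^ (2 / (p - q - 1)))
        (Num.max
          ((lambda * card_S `^ ((p - q - 1) / 2) / lambda_p0)
             `^ (2 / (p - q - 1)))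
          ((lambda * card_S `^ ((1 - q) / 2) / lambda_p0)
             `^ (2 / (p - q - 1))))).
Proof.
case: u_sol => sol maximal.
have T_oo : T = +oo%E.
  case: T sol maximal => [T| |] sol maximal //; last by case: (sol).
  have [d [v d0 [v_sol vu]]] := solution_extends S_connected p_gt1 lambda_gt0 q_gt0
    q_lt mu_ge0 sigma_ge0 mu_sigma_gt0 sigma_neq0 sol.
  have : (T + d)%:E = T%:E.
    apply: (maximal _ v v_sol); first by rewrite lee_fin lerDl ltW.
    by move=> x t xD t0; rewrite lte_fin => tT; exact: vu.
  by move=> [Td]; move: d0; rewrite -(ltrDl T) Td ltxx.
split=> // t t0.
apply: (mass_le_bound S_connected p_gt1 lambda_gt0 q_gt0 q_lt mu_ge0 sigma_ge0
  mu_sigma_gt0 sigma_neq0 sol t0).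
by rewrite T_oo ltry.
Qed.
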